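(* Let $\mathbb K$ be an algebraically closed field, $n\ge2$, $r,s\in\mathbb K$ nonzero, $r\ne s$, and $\widetilde U=U_{r,s}(\mathfrak{gl}_n)$. Then for any $\widetilde U$-module $M$ in the category $\mathcal O$, the operator $\Omega\,\Xi:M\to M$ commutes with the action of $\widetilde U$ on $M$.
   Context: Let $\epsilon_1,\dots,\epsilon_n$ be an orthonormal basis of $\mathbb R^n$ with inner product $\langle\,,\rangle$, $\alpha_j=\epsilon_j-\epsilon_{j+1}$ for $1\le j<n$, $\Lambda=\bigoplus_{i=1}^n\mathbb Z\epsilon_i$, $Q^+=\sum_{i=1}^{n-1}\mathbb Z_{\ge0}\alpha_i$. $\widetilde U=U_{r,s}(\mathfrak{gl}_n)$ is the unital associative $\mathbb K$-algebra generated by $e_j,f_j$ ($1\le j<n$), $a_i^{\pm1},b_i^{\pm1}$ ($1\le i\le n$) with relations: (R1) the $a_i^{\pm1},b_j^{\pm1}$ all commute and $a_ia_i^{-1}=b_jb_j^{-1}=1$; (R2) $a_ie_j=r^{\langle\epsilon_i,\alpha_j\rangle}e_ja_i$, $a_if_j=r^{-\langle\epsilon_i,\alpha_j\rangle}f_ja_i$; (R3) $b_ie_j=s^{\langle\epsilon_i,\alpha_j\rangle}e_jb_i$, $b_if_j=s^{-\langle\epsilon_i,\alpha_j\rangle}f_jb_i$; (R4) $[e_i,f_j]=\frac{\delta_{i,j}}{r-s}(a_ib_{i+1}-a_{i+1}b_i)$; (R5) $[e_i,e_j]=[f_i,f_j]=0$ if $|i-j|>1$; (R6) $e_i^2e_{i+1}-(r+s)e_ie_{i+1}e_i+rs\,e_{i+1}e_i^2=0$,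 $e_ie_{i+1}^2-(r+s)e_{i+1}e_ie_{i+1}+rs\,e_{i+1}^2e_i=0$; (R7) $f_i^2f_{i+1}-(r^{-1}+s^{-1})f_if_{i+1}f_i+r^{-1}s^{-1}f_{i+1}f_i^2=0$, $f_if_{i+1}^2-(r^{-1}+s^{-1})f_{i+1}f_if_{i+1}+r^{-1}s^{-1}f_{i+1}^2f_i=0$. With $\omega_j=a_jb_{j+1}$, $\omega_j'=a_{j+1}b_j$, it is a Hopf algebra with $a_i^{\pm1},b_i^{\pm1}$ group-like, $\Delta(e_i)=e_i\otimes1+\omega_i\otimes e_i$, $\Delta(f_i)=1\otimes f_i+f_i\otimes\omega_i'$, $\varepsilon(e_i)=\varepsilon(f_i)=0$, antipode $S(a_i)=a_i^{-1}$, $S(b_i)=b_i^{-1}$, $S(e_i)=-\omega_i^{-1}e_i$, $S(f_i)=-f_i(\omega_i')^{-1}$. Pairing: $\widetilde B$ is the Hopf subalgebra generated by all $e_j,\omega_j^{\pm1}$ and $a_n^{\pm1}$; $\widetilde B'$ is the subalgebra generated by all $f_j,(\omega_j')^{\pm1}$ and $b_n^{\pm1}$, with the coproduct opposite to that of $\widetilde U$. The bilinear form $(\,,)$ on $\widetilde B'\times\widetilde B$ is the Hopf pairing (i.e. $(1,h)=\varepsilon(h)$, $(h',1)=\varepsilon(h')$, $(h',hk)=\sum(h'_{(1)},h)(h'_{(2)},k)$, $(h'k',h)=\sum(h',h_{(1)})(k',h_{(2)})$, using these coproducts) determined by $(f_i,e_j)=\frac{\delta_{i,j}}{s-r}$,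 $(\omega_i',\omega_j)=r^{\langle\epsilon_j,\alpha_i\rangle}s^{\langle\epsilon_{j+1},\alpha_i\rangle}$, $(b_n,a_n)=1$, $(b_n,\omega_j)=s^{-\langle\epsilon_n,\alpha_j\rangle}$, $(\omega_i',a_n)=r^{\langle\epsilon_n,\alpha_i\rangle}$, inverses of group-like generators giving inverse values, and $0$ on all other pairs of generators. $U^+$ (resp. $U^-$) is the subalgebra generated by $1$ and the $e_i$ (resp. $f_i$), $1\le i<n$; for $\zeta\in Q^+$, $U^+_\zeta$ (resp. $U^-_{-\zeta}$) is the span of monomials $e_{i_1}\cdots e_{i_\ell}$ (resp. $f_{i_1}\cdots f_{i_\ell}$) with $\alpha_{i_1}+\cdots+\alpha_{i_\ell}=\zeta$. The spaces $U^+_\zeta$ and $U^-_{-\zeta}$ are nondegenerately paired by $(\,,)$. Let $\{u_k^\zeta\}_{k=1}^{d_\zeta}$ be a basis of $U^+_\zeta$ ($d_\zeta=\dim U_\zeta^+$) and $\{v_k^\zeta\}_{k=1}^{d_\zeta}$ the dual basis of $U^-_{-\zeta}$, $(v_k^\zeta,u_l^\zeta)=\delta_{k,l}$. Category $\mathcal O$: $\widetilde U$-modules $M$ such that $M=\bigoplus_{\lambda\in\mathrm{wt}(M)}M_\lambda$ with the set of weights $\mathrm{wt}(M)\subseteq\Lambda$, where $M_\lambda=\{m: a_i m=r^{\langle\epsilon_i,\lambda\rangle}m,\ b_i m=s^{\langle\epsilon_i,\lambda\rangle}m\ \forall i\}$; $\dim M_\lambda<\infty$ for all $\lambda\in\mathrm{wt}(M)$;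 and $\mathrm{wt}(M)\subseteq\bigcup_{\mu\in F}(\mu-Q^+)$ for some finite $F\subset\Lambda$. $\Omega=\sum_{\zeta\in Q^+}\sum_{k=1}^{d_\zeta}S(v_k^\zeta)u_k^\zeta$, acting on modules $M\in\mathcal O$ (only finitely many $\zeta$ contribute on a given vector). Let $2\rho=\sum_{j=1}^n(n+1-2j)\epsilon_j$ (the sum of the positive roots). With a fixed square root $(rs^{-1})^{1/2}$ in $\mathbb K$, put $g(\lambda)=(rs^{-1})^{\frac12\langle\lambda+2\rho,\lambda\rangle}$ for $\lambda\in\Lambda$. The linear operator $\Xi:M\to M$ is $\Xi(m)=g(\lambda)m$ for all $m\in M_\lambda$, $\lambda\in\Lambda$. *)

(* Defs.v *)
From HB Require Import structures.
From mathcomp Require Import all_boot all_order all_algebra.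
From mathcomp Require Import generic_quotient.
From mathcomp Require Import mathcomp_extra boolp classical_sets fsbigop.

Set Implicit Arguments.
Unset Strict Implicit.
Unset Printing Implicit Defensive.

Import Order.TTheory GRing.Theory Num.Theory.

Local Open Scope classical_set_scope.
Local Open Scope quotient_scope.
Local Open Scope ring_scope.

(* Unital associative algebras presented by generators [G] and relations
   [Rel]: terms modulo the least congruence containing the algebra axioms and
   [Rel]. *)
Inductive aterm (K G : Type) : Type :=
| Gen of G
| TZero
| TOne
| TAdd of aterm K G & aterm K G
| TOpp of aterm K G
| TMul of aterm K G & aterm K G
| TScale of K & aterm K G.

Arguments Gen {K G}.
Arguments TZero {K G}.
Arguments TOne {K G}.

Declare Scope aterm_scope.
Delimit Scope aterm_scope with aterm.
Bind Scope aterm_scope with aterm.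
Notation "0" := TZero : aterm_scope.
Notation "1" := TOne : aterm_scope.
Notation "x + y" := (TAdd x y) : aterm_scope.
Notation "- x" := (TOpp x) : aterm_scope.
Notation "x - y" := (TAdd x (TOpp y)) : aterm_scope.
Notation "x * y" := (TMul x y) : aterm_scope.
Notation "c *: x" := (TScale c%R x) : aterm_scope.

HB.instance Definition _ (K G : Type) := gen_eqMixin (aterm K G).
HB.instance Definition _ (K G : Type) := gen_choiceMixin (aterm K G).

Section Presented.
Variables (K : fieldType) (G : Type).
Variable Rel : aterm K G -> aterm K G -> Prop.

Inductive tcong : aterm K G -> aterm K G -> Prop :=
| tc_rel x y : Rel x y -> tcong x y
| tc_refl x : tcong x x
| tc_sym x y : tcong x y -> tcong y x
| tc_trans y x z : tcong x y -> tcong y z -> tcong x z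
| tc_add x x' y y' : tcong x x' -> tcong y y' -> tcong (x + y) (x' + y')
| tc_opp x x' : tcong x x' -> tcong (- x) (- x')
| tc_mul x x' y y' : tcong x x' -> tcong y y' -> tcong (x * y) (x' * y')
| tc_scale c x x' : tcong x x' -> tcong (c *: x) (c *: x')
| tc_addA x y z : tcong (x + (y + z)) ((x + y) + z)
| tc_addC x y : tcong (x + y) (y + x)
| tc_add0 x : tcong (0 + x) x
| tc_addN x : tcong (- x + x) 0
| tc_mulA x y z : tcong (x * (y * z)) ((x * y) * z)
| tc_mul1l x : tcong (1 * x) x
| tc_mul1r x : tcong (x * 1) x
| tc_mulDl x y z : tcong ((x + y) * z) (x * z + y * z)
| tc_mulDr x y z : tcong (x * (y + z)) (x * y + x * z)
| tc_scaleA c d x : tcong (c *: (d *: x)) ((c * d) *: x)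
| tc_scale1 x : tcong (1 *: x) x
| tc_scaleDr c x y : tcong (c *: (x + y)) (c *: x + c *: y)
| tc_scaleDl c d x : tcong ((c + d) *: x) (c *: x + d *: x)
| tc_scaleAl c x y : tcong (c *: (x * y)) ((c *: x) * y)
| tc_scaleAr c x y : tcong (c *: (x * y)) (x * (c *: y)).

Definition tcongb : rel (aterm K G) := fun x y => `[< tcong x y >].

Lemma tcongb_refl : reflexive tcongb.
Proof. by move=> x; apply/asboolP/tc_refl. Qed.

Lemma tcongb_sym : symmetric tcongb.
Proof. by move=> x y; apply/asboolP/asboolP; exact: tc_sym. Qed.

Lemma tcongb_trans : transitive tcongb.
Proof.
move=> y x z /asboolP xy /asboolP yz; apply/asboolP; exact: tc_trans xy yz.
Qed.

Canonical tcong_equiv := EquivRel tcongb tcongb_refl tcongb_sym tcongb_trans.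

Definition palg : Type := {eq_quot tcong_equiv}.

HB.instance Definition _ := Choice.on palg.

Local Notation cl := (\pi_({eq_quot tcong_equiv}) : aterm K G -> palg).
Local Notation rp := (repr : palg -> aterm K G).

Lemma palg_eqP x y : tcong x y <-> cl x = cl y.
Proof.
by split=> [xy|/eqmodP/asboolP//]; apply/eqmodP/asboolP.
Qed.

Lemma cl_surj (x : palg) : cl (rp x) = x.
Proof. exact: reprK. Qed.

Lemma rp_cl x : tcong (rp (cl x)) x.
Proof. by apply/palg_eqP; rewrite cl_surj. Qed.

Definition palg_gen (g : G) : palg := cl (Gen g).
Definition padd (x y : palg) : palg := cl (rp x + rp y)%aterm.
Definition popp (x : palg) : palg := cl (- rp x)%aterm.
Definition pmul (x y : palg) : palg := cl (rp x * rp y)%aterm.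
Definition pscale (c : K) (x : palg) : palg := cl (c *: rp x)%aterm.

Lemma paddE x y : padd (cl x) (cl y) = cl (x + y)%aterm.
Proof. by apply/palg_eqP/tc_add; exact: rp_cl. Qed.

Lemma poppE x : popp (cl x) = cl (- x)%aterm.
Proof. by apply/palg_eqP/tc_opp; exact: rp_cl. Qed.

Lemma pmulE x y : pmul (cl x) (cl y) = cl (x * y)%aterm.
Proof. by apply/palg_eqP/tc_mul; exact: rp_cl. Qed.

Lemma pscaleE c x : pscale c (cl x) = cl (c *: x)%aterm.
Proof. by apply/palg_eqP/tc_scale; exact: rp_cl. Qed.

Local Ltac palg_law law :=
  repeat (let x := fresh "x" in
    move=> x; match type of x with
              | palg => rewrite -(cl_surj x) | _ => idtac end);
  rewrite !(paddE, poppE, pmulE, pscaleE); apply/palg_eqP; exact: law.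

Lemma paddA : associative padd. Proof. palg_law tc_addA. Qed.
Lemma paddC : commutative padd. Proof. palg_law tc_addC. Qed.
Lemma padd0 : left_id (cl TZero) padd. Proof. palg_law tc_add0. Qed.
Lemma paddN : left_inverse (cl TZero) popp padd.
Proof. palg_law tc_addN. Qed.
HB.instance Definition _ := GRing.isZmodule.Build palg paddA paddC padd0 paddN.

Lemma pmulA : associative pmul. Proof. palg_law tc_mulA. Qed.
Lemma pmul1l : left_id (cl TOne) pmul. Proof. palg_law tc_mul1l. Qed.
Lemma pmul1r : right_id (cl TOne) pmul. Proof. palg_law tc_mul1r. Qed.
Lemma pmulDl : left_distributive pmul padd. Proof. palg_law tc_mulDl. Qed.
Lemma pmulDr : right_distributive pmul padd. Proof. palg_law tc_mulDr. Qed.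
HB.instance Definition _ :=
  GRing.Zmodule_isPzRing.Build palg pmulA pmul1l pmul1r pmulDl pmulDr.

Lemma pscaleA c d x : pscale c (pscale d x) = pscale (c * d) x.
Proof. by move: x; palg_law tc_scaleA. Qed.
Lemma pscale1 : left_id 1 pscale. Proof. palg_law tc_scale1. Qed.
Lemma pscaleDr : right_distributive pscale padd.
Proof. palg_law tc_scaleDr. Qed.
Lemma pscaleDl x : {morph pscale^~ x : c d / c + d >-> padd c d}.
Proof. by move: x => x c d; move: x; palg_law tc_scaleDl. Qed.
HB.instance Definition _ :=
  GRing.Zmodule_isLmodule.Build K palg pscaleA pscale1 pscaleDr pscaleDl.

Lemma pscaleAl c (x y : palg) : c *: (x * y) = (c *: x) * y.
Proof.
rewrite -[LHS]/(pscale c (pmul x y)) -[RHS]/(pmul (pscale c x) y).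
by move: x y; palg_law tc_scaleAl.
Qed.
Lemma pscaleAr c (x y : palg) : c *: (x * y) = x * (c *: y).
Proof.
rewrite -[LHS]/(pscale c (pmul x y)) -[RHS]/(pmul x (pscale c y)).
by move: x y; palg_law tc_scaleAr.
Qed.
(* [palg] may be the zero ring, so that [algType] instances are only declared
   below, for the presentations that are shown to be nontrivial. *)

Section Lift.
Variables (A : algType K) (phi : G -> A).

Fixpoint teval (x : aterm K G) : A :=
  match x with
  | Gen g => phi g
  | TZero => 0
  | TOne => 1
  | TAdd x y => teval x + teval y
  | TOpp x => - teval x
  | TMul x y => teval x * teval y
  | TScale c x => c *: teval x
  end.

Hypothesis phi_rel : forall x y, Rel x y -> teval x = teval y.

Lemma teval_cong x y : tcong x y -> teval x = teval y.
Proof.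
elim=> {x y} //=; last by move=> *; exact: scalerAr.
- by move=> x y z _ -> _ ->.
- by move=> x x' y y' _ -> _ ->.
- by move=> x x' _ ->.
- by move=> x x' y y' _ -> _ ->.
- by move=> c x x' _ ->.
- by move=> *; exact: addrA.
- by move=> *; exact: addrC.
- by move=> *; exact: add0r.
- by move=> *; exact: addNr.
- by move=> *; exact: mulrA.
- by move=> *; exact: mul1r.
- by move=> *; exact: mulr1.
- by move=> *; exact: mulrDl.
- by move=> *; exact: mulrDr.
- by move=> *; exact: scalerA.
- by move=> *; exact: scale1r.
- by move=> *; exact: scalerDr.
- by move=> *; exact: scalerDl.
- by move=> *; exact: scalerAl.
Qed.

Definition palg_lift (x : palg) : A := teval (rp x).

Lemma palg_lift_cl x : palg_lift (cl x) = teval x.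
Proof. exact/teval_cong/rp_cl. Qed.

Lemma palg_lift_gen g : palg_lift (palg_gen g) = phi g.
Proof. exact: palg_lift_cl. Qed.

Lemma palg_liftD x y : palg_lift (x + y) = palg_lift x + palg_lift y.
Proof.
by rewrite -(cl_surj x) -(cl_surj y) [_ + _]paddE !palg_lift_cl.
Qed.

Lemma palg_liftM x y : palg_lift (x * y) = palg_lift x * palg_lift y.
Proof.
by rewrite -(cl_surj x) -(cl_surj y) [_ * _]pmulE !palg_lift_cl.
Qed.

Lemma palg_liftZ c x : palg_lift (c *: x) = c *: palg_lift x.
Proof. by rewrite -(cl_surj x) [_ *: _]pscaleE !palg_lift_cl. Qed.

Lemma palg_lift1 : palg_lift 1 = 1.
Proof. exact: palg_lift_cl. Qed.

Lemma palg_lift0 : palg_lift 0 = 0.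
Proof. exact: palg_lift_cl. Qed.

Lemma palg_neq0 : (1 : palg) != 0.
Proof.
apply/eqP => /(congr1 palg_lift)/eqP.
by rewrite palg_lift1 palg_lift0 oner_eq0.
Qed.

End Lift.

End Presented.

(* The tensor product algebra: as the pure tensors are closed under the
   product, this presentation yields the usual algebra structure on the
   K-module A (x) B. *)
Section Tensor.
Variables (K : fieldType) (A B : algType K).

Inductive tensor_rel : aterm K (A * B) -> aterm K (A * B) -> Prop :=
| tens_Dl a a' b :
    tensor_rel (Gen (a + a', b)%R) (Gen (a, b) + Gen (a', b))
| tens_Dr a b b' :
    tensor_rel (Gen (a, b + b')%R) (Gen (a, b) + Gen (a, b'))
| tens_Zl c a b : tensor_rel (Gen (c *: a, b)%R) (c *: Gen (a, b))
| tens_Zr c a b : tensor_rel (Gen (a, c *: b)%R) (c *: Gen (a, b))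
| tens_1 : tensor_rel (Gen (1, 1)%R) 1
| tens_M a a' b b' :
    tensor_rel (Gen (a * a', b * b')%R) (Gen (a, b) * Gen (a', b')).

Definition tensor : Type := palg tensor_rel.
HB.instance Definition _ := GRing.PzRing.on tensor.
HB.instance Definition _ := GRing.Lmodule.on tensor.

Definition tens (a : A) (b : B) : tensor := palg_gen tensor_rel (a, b).

End Tensor.

Section LinearAlgebra.
Variables (K : fieldType) (V : lmodType K).

Definition span (X : set V) : set V :=
  [set x | exists s : seq (K * V),
     (forall p, p \in s -> X p.2) /\ x = \sum_(p <- s) p.1 *: p.2].

Definition is_basis (W : set V) (d : nat) (u : 'I_d -> V) : Prop :=
  [/\ forall k, W (u k),
      forall x, W x -> exists c : 'I_d -> K, x = \sum_k c k *: u k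
    & forall c : 'I_d -> K, \sum_k c k *: u k = 0 -> forall k, c k = 0].

End LinearAlgebra.

Inductive subalg (K : fieldType) (A : algType K) (X : set A) : set A :=
| subalg_gen x : X x -> subalg X x
| subalg_1 : subalg X 1
| subalg_D x y : subalg X x -> subalg X y -> subalg X (x + y)
| subalg_Z c x : subalg X x -> subalg X (c *: x)
| subalg_M x y : subalg X x -> subalg X y -> subalg X (x * y).

Notation lattice n := 'rV[int]_n.

Section WeightLattice.
Variable n : nat.

Definition ip (x y : lattice n) : int := \sum_(i < n) x 0 i * y 0 i.

Definition eps (i : 'I_n) : lattice n := delta_mx 0 i.

(* Indices are shifted to start at 0: for [j : 'I_n.-1], [lo j] and [hi j] are
   the positions j and j + 1 among the n basis vectors. *)
Lemma lo_subproof (j : 'I_n.-1) : (j < n)%N.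
Proof. exact: leq_trans (ltn_ord j) (leq_pred n). Qed.
Lemma hi_subproof (j : 'I_n.-1) : (j.+1 < n)%N.
Proof. by rewrite -ltn_predRL. Qed.
Definition lo (j : 'I_n.-1) : 'I_n := Ordinal (lo_subproof j).
Definition hi (j : 'I_n.-1) : 'I_n := Ordinal (hi_subproof j).

Definition alpha (j : 'I_n.-1) : lattice n := eps (lo j) - eps (hi j).

Definition Qplus : set (lattice n) :=
  [set z | exists c : 'I_n.-1 -> nat, z = \sum_(j < n.-1) alpha j *+ c j].

(* The i-th coordinate is n + 1 - 2 (i + 1), the position i starting at 0. *)
Definition two_rho : lattice n :=
  \row_(i < n) (n%:Z + 1 - 2 * i.+1%:Z).

End WeightLattice.

Arguments Qplus n : clear implicits.
Arguments two_rho n : clear implicits.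

(* In [GA d i] and [GB d i] the boolean [d] is [false] for a_i, b_i and [true]
   for the inverses. *)
Inductive uq_gen (n : nat) : Type :=
| GE of 'I_n.-1
| GF of 'I_n.-1
| GA of bool & 'I_n
| GB of bool & 'I_n.

Arguments GE {n}.
Arguments GF {n}.
Arguments GA {n}.
Arguments GB {n}.

Definition is_torus n (g : uq_gen n) : bool :=
  match g with GA _ _ | GB _ _ => true | _ => false end.

Section TwoParameter.
Variables (K : fieldType) (n : nat) (r s : K).

Local Notation te j := (Gen (GE j) : aterm K (uq_gen n)).
Local Notation tf j := (Gen (GF j) : aterm K (uq_gen n)).
Local Notation ta i := (Gen (GA false i) : aterm K (uq_gen n)).
Local Notation tb i := (Gen (GB false i) : aterm K (uq_gen n)).
Local Notation ta' i := (Gen (GA true i) : aterm K (uq_gen n)).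
Local Notation tb' i := (Gen (GB true i) : aterm K (uq_gen n)).

Inductive uq_rel : aterm K (uq_gen n) -> aterm K (uq_gen n) -> Prop :=
| R1_comm g h : is_torus g -> is_torus h ->
    uq_rel (Gen g * Gen h) (Gen h * Gen g)
| R1_a i : uq_rel (ta i * ta' i) 1
| R1_b i : uq_rel (tb i * tb' i) 1
| R2_e i j : uq_rel (ta i * te j) (r ^ ip (eps i) (alpha j) *: (te j * ta i))
| R2_f i j :
    uq_rel (ta i * tf j) (r ^ (- ip (eps i) (alpha j)) *: (tf j * ta i))
| R3_e i j : uq_rel (tb i * te j) (s ^ ip (eps i) (alpha j) *: (te j * tb i))
| R3_f i j :
    uq_rel (tb i * tf j) (s ^ (- ip (eps i) (alpha j)) *: (tf j * tb i))
| R4 i j :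
    uq_rel (te i * tf j - tf j * te i)
      (((i == j)%:R / (r - s)) *: (ta (lo i) * tb (hi i) - ta (hi i) * tb (lo i)))
| R5_e (i j : 'I_n.-1) : (i.+1 < j)%N || (j.+1 < i)%N -> uq_rel (te i * te j - te j * te i) 0
| R5_f (i j : 'I_n.-1) : (i.+1 < j)%N || (j.+1 < i)%N -> uq_rel (tf i * tf j - tf j * tf i) 0
| R6_l (i j : 'I_n.-1) : j = i.+1 :> nat ->
    uq_rel (te i * te i * te j - (r + s) *: (te i * te j * te i)
            + (r * s) *: (te j * te i * te i)) 0
| R6_r (i j : 'I_n.-1) : j = i.+1 :> nat ->
    uq_rel (te i * te j * te j - (r + s) *: (te j * te i * te j)
            + (r * s) *: (te j * te j * te i)) 0
| R7_l (i j : 'I_n.-1) : j = i.+1 :> nat ->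
    uq_rel (tf i * tf i * tf j - (r^-1 + s^-1) *: (tf i * tf j * tf i)
            + (r^-1 * s^-1) *: (tf j * tf i * tf i)) 0
| R7_r (i j : 'I_n.-1) : j = i.+1 :> nat ->
    uq_rel (tf i * tf j * tf j - (r^-1 + s^-1) *: (tf j * tf i * tf j)
            + (r^-1 * s^-1) *: (tf j * tf j * tf i)) 0.

Definition Uq : Type := palg uq_rel.
HB.instance Definition _ := GRing.PzRing.on Uq.
HB.instance Definition _ := GRing.Lmodule.on Uq.

(* The counit is the algebra morphism sending each a_i^{+-1}, b_i^{+-1} to 1 and
   each e_j, f_j to 0. *)
Definition counit_val (g : uq_gen n) : K^o := (is_torus g)%:R.

Lemma counit_rel x y : uq_rel x y -> teval counit_val x = teval counit_val y.
Proof.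
case=> {x y} /=; rewrite /counit_val /=; intros;
  rewrite ?(mulr0, mul0r, mulr1, mul1r, subrr, scaler0, addr0, oppr0) //.
by rewrite [LHS]mulrC.
Qed.

HB.instance Definition _ := GRing.PzSemiRing_isNonZero.Build Uq
  (palg_neq0 counit_rel).
HB.instance Definition _ := GRing.LSemiModule_isLSemiAlgebra.Build K Uq
  (@pscaleAl _ _ uq_rel).
HB.instance Definition _ := GRing.LSemiAlgebra_isSemiAlgebra.Build K Uq
  (@pscaleAr _ _ uq_rel).

Definition counit (x : Uq) : K^o := palg_lift counit_val x.

Definition Uq2 : Type := tensor Uq Uq.
HB.instance Definition _ := GRing.PzRing.on Uq2.
HB.instance Definition _ := GRing.Lmodule.on Uq2.

Lemma counit2_rel x y : tensor_rel x y ->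
  teval (fun q : Uq * Uq => counit q.1 * counit q.2) x =
  teval (fun q : Uq * Uq => counit q.1 * counit q.2) y.
Proof.
rewrite /counit; case=> {x y} /= [a a' b|a b b'|c a b|c a b||a a' b b'].
- by rewrite (palg_liftD counit_rel) mulrDl.
- by rewrite (palg_liftD counit_rel) mulrDr.
- by rewrite (palg_liftZ counit_rel) scalerAl.
- by rewrite (palg_liftZ counit_rel) scalerAr.
- by rewrite (palg_lift1 counit_rel) mulr1.
- by rewrite !(palg_liftM counit_rel) mulrACA.
Qed.

HB.instance Definition _ := GRing.PzSemiRing_isNonZero.Build Uq2
  (palg_neq0 counit2_rel).
HB.instance Definition _ := GRing.LSemiModule_isLSemiAlgebra.Build K Uq2
  (@pscaleAl _ _ (@tensor_rel K Uq Uq)).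
HB.instance Definition _ := GRing.LSemiAlgebra_isSemiAlgebra.Build K Uq2
  (@pscaleAr _ _ (@tensor_rel K Uq Uq)).

Definition uE (j : 'I_n.-1) : Uq := palg_gen uq_rel (GE j).
Definition uF (j : 'I_n.-1) : Uq := palg_gen uq_rel (GF j).
Definition uA (d : bool) (i : 'I_n) : Uq := palg_gen uq_rel (GA d i).
Definition uB (d : bool) (i : 'I_n) : Uq := palg_gen uq_rel (GB d i).

(* omega_j^{+-1} and omega'_j^{+-1}, the sign being encoded as in [uq_gen]. *)
Definition omega (d : bool) (j : 'I_n.-1) : Uq := uA d (lo j) * uB d (hi j).
Definition omega' (d : bool) (j : 'I_n.-1) : Uq := uA d (hi j) * uB d (lo j).

(* The coproduct is an algebra morphism and the antipode an anti-morphism: both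
   are determined by their values on the generators. *)
Record is_hopf (Delta : {lrmorphism Uq -> Uq2}) (S : {linear Uq -> Uq}) : Prop := IsHopf {
  comul_A : forall d i, Delta (uA d i) = tens (uA d i) (uA d i);
  comul_B : forall d i, Delta (uB d i) = tens (uB d i) (uB d i);
  comul_E : forall j, Delta (uE j) = tens (uE j) 1 + tens (omega false j) (uE j);
  comul_F : forall j, Delta (uF j) = tens 1 (uF j) + tens (uF j) (omega' false j);
  antipode_1 : S 1 = 1;
  antipode_M : forall x y, S (x * y) = S y * S x;
  antipode_A : forall d i, S (uA d i) = uA (~~ d) i;
  antipode_B : forall d i, S (uB d i) = uB (~~ d) i;
  antipode_E : forall j, S (uE j) = - (omega true j * uE j);
  antipode_F : forall j, S (uF j) = - (uF j * omega' true j)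
}.

(* [i.+1 = n] says that i is the last of the n positions. *)
Definition Bp : set Uq := subalg
  [set x | [\/ exists j, x = uE j, exists d j, x = omega d j
             | exists d (i : 'I_n), i.+1 = n /\ x = uA d i]].
Definition Bm : set Uq := subalg
  [set x | [\/ exists j, x = uF j, exists d j, x = omega' d j
             | exists d (i : 'I_n), i.+1 = n /\ x = uB d i]].

(* Only the values of [p] on [Bm] x [Bp] matter. The Sweedler sums are taken
   over arbitrary decompositions of [Delta x] inside [Bm] (x) [Bm], resp.
   [Bp] (x) [Bp]; in [pair_mulr] the two legs are exchanged because [Bm] carries
   the opposite coproduct. The exponents (-1) ^+ (d + d') account for the
   inverses of the group-like generators. *)
Record is_hopf_pairing (Delta : {lrmorphism Uq -> Uq2}) (p : Uq -> Uq -> K) : Prop := IsHopfPairing {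
  pair_linearl : forall c x x' y, Bm x -> Bm x' -> Bp y ->
    p (c *: x + x') y = c * p x y + p x' y;
  pair_linearr : forall c x y y', Bm x -> Bp y -> Bp y' ->
    p x (c *: y + y') = c * p x y + p x y';
  pair_1l : forall y, Bp y -> p 1 y = counit y;
  pair_1r : forall x, Bm x -> p x 1 = counit x;
  pair_mulr : forall x y z (l : seq (Uq * Uq)), Bm x -> Bp y -> Bp z ->
    (forall q, q \in l -> Bm q.1 /\ Bm q.2) ->
    Delta x = \sum_(q <- l) tens q.1 q.2 ->
    p x (y * z) = \sum_(q <- l) p q.2 y * p q.1 z;
  pair_mull : forall x z y (l : seq (Uq * Uq)), Bm x -> Bm z -> Bp y ->
    (forall q, q \in l -> Bp q.1 /\ Bp q.2) ->
    Delta y = \sum_(q <- l) tens q.1 q.2 ->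
    p (x * z) y = \sum_(q <- l) p x q.1 * p z q.2;
  pair_FE : forall i j, p (uF i) (uE j) = (i == j)%:R / (s - r);
  pair_ww : forall d d' i j, p (omega' d i) (omega d' j) =
    (r ^ ip (eps (lo j)) (alpha i) * s ^ ip (eps (hi j)) (alpha i))
      ^ ((-1) ^+ (d + d'));
  pair_ba : forall d d' (i : 'I_n), i.+1 = n -> p (uB d i) (uA d' i) = 1;
  pair_bw : forall d d' (i : 'I_n) j, i.+1 = n -> p (uB d i) (omega d' j) =
    (s ^ (- ip (eps i) (alpha j))) ^ ((-1) ^+ (d + d'));
  pair_wa : forall d d' i (k : 'I_n), k.+1 = n -> p (omega' d i) (uA d' k) =
    (r ^ ip (eps k) (alpha i)) ^ ((-1) ^+ (d + d'));
  pair_Fw : forall d i j, p (uF i) (omega d j) = 0;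
  pair_Fa : forall d i (k : 'I_n), k.+1 = n -> p (uF i) (uA d k) = 0;
  pair_wE : forall d i j, p (omega' d i) (uE j) = 0;
  pair_bE : forall d (i : 'I_n) j, i.+1 = n -> p (uB d i) (uE j) = 0
}.

Definition Uplus (z : lattice n) : set Uq := span
  [set x | exists l : seq 'I_n.-1,
     \sum_(j <- l) alpha j = z /\ x = \prod_(j <- l) uE j].
Definition Uminus_opp (z : lattice n) : set Uq := span
  [set x | exists l : seq 'I_n.-1,
     \sum_(j <- l) alpha j = z /\ x = \prod_(j <- l) uF j].

(* In a [Uq]-module, [c%:A *: m] is the action of the scalar [c : K]. *)
Section CategoryO.
Variable M : lmodType Uq.

Definition weight_space (la : lattice n) : set M :=
  [set m | forall i,
     uA false i *: m = (r ^ ip (eps i) la)%:A *: m /\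
     uB false i *: m = (s ^ ip (eps i) la)%:A *: m].

Definition wt : set (lattice n) :=
  [set la | exists m, weight_space la m /\ m <> 0].

Record in_catO : Prop := InCatO {
  catO_sum : forall m : M, exists (l : seq (lattice n)) (x : lattice n -> M),
    [/\ uniq l, forall la, la \in l -> wt la /\ weight_space la (x la)
      & m = \sum_(la <- l) x la];
  catO_direct : forall (l : seq (lattice n)) (x : lattice n -> M),
    uniq l -> (forall la, la \in l -> wt la /\ weight_space la (x la)) ->
    \sum_(la <- l) x la = 0 -> forall la, la \in l -> x la = 0;
  catO_findim : forall la, wt la -> exists l : seq M,
    (forall m, m \in l -> weight_space la m) /\
    forall m, weight_space la m -> exists c : 'I_(size l) -> K,
      m = \sum_k (c k)%:A *: l`_k;
  catO_bounded : exists F : seq (lattice n), forall la, wt la ->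
    exists mu z, [/\ mu \in F, Qplus n z & la = mu - z]
}.

(* The outer sum is the finitely supported sum of [fsbigop]. *)
Definition Omega (S : Uq -> Uq) (d : lattice n -> nat)
    (u v : forall z, 'I_(d z) -> Uq) (m : M) : M :=
  \sum_(z \in Qplus n) \sum_(k < d z) (S (v z k) * u z k) *: m.

(* [t] is the chosen square root of r / s. *)
Record is_Xi (t : K) (Xi : M -> M) : Prop := IsXi {
  Xi_linear : forall (c : K) m m',
    Xi (c%:A *: m + m') = c%:A *: Xi m + Xi m';
  Xi_weight : forall la m, weight_space la m ->
    Xi m = (t ^ ip (la + two_rho n) la)%:A *: m
}.

End CategoryO.

End TwoParameter.

Arguments Uplus {K n} r s z.
Arguments Uminus_opp {K n} r s z.

(* Main.v *)
Require Import Defs.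
From HB Require Import structures.
From mathcomp Require Import all_boot all_order all_algebra.
From mathcomp Require Import generic_quotient.
From mathcomp Require Import mathcomp_extra boolp classical_sets functions.
From mathcomp Require Import cardinality fsbigop.
From mathcomp Require Import zify ring.

Import Order.TTheory GRing.Theory Num.Theory.

Set Implicit Arguments.
Unset Strict Implicit.
Unset Printing Implicit Defensive.

Local Open Scope ring_scope.

(** For x in U^+_zeta one has [x, f_i] = (A omega_i - omega'_i B) / (r - s) with
    A, B in U^+_(zeta - alpha_i), where the linear maps A and B are adjoint under
    the pairing to right and left multiplication by f_i.  Expanding in dual
    bases, Theta_zeta = sum_k S(v_k) u_k satisfies
      Theta_zeta f_i = G_zeta - G_(zeta - alpha_i)
                       - S(f_i) Theta_(zeta - alpha_i) omega_i,
    with G_zeta = sum_k S(v_k) f_i u_k.  Summing over zeta telescopes to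
    Omega f_i = - S(f_i) Omega omega_i, and symmetrically
    S(e_i) Omega = - S(omega'_i) Omega e_i.  On a weight space these relations
    say that Omega commutes with e_i and f_i up to a power of r / s, which is
    exactly the ratio of the values of g at neighbouring weights. *)

Local Notation span := Defs.span.

(** * Linear spans in a module *)

Section Span.
Variables (K : fieldType) (V : lmodType K) (X : set V).

Lemma span_ind (Q : V -> Prop) :
  Q 0 -> (forall c x y, X x -> Q y -> Q (c *: x + y)) ->
  forall x, span X x -> Q x.
Proof.
move=> Q0 QD x [l [Xl ->]]; elim: l Xl => [|q l IHl] Xl; first by rewrite big_nil.
rewrite big_cons; apply: QD; first by apply: Xl; rewrite mem_head.
by apply: IHl => q' lq'; apply: Xl; rewrite inE lq' orbT.
Qed.

Lemma span0 : span X 0.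
Proof. by exists [::]; rewrite big_nil. Qed.

Lemma span_cons c x y : X x -> span X y -> span X (c *: x + y).
Proof.
move=> Xx [l [Xl ->]]; exists ((c, x) :: l); rewrite big_cons; split=> // q.
by rewrite inE => /predU1P[->|/Xl].
Qed.

Lemma span_gen x : X x -> span X x.
Proof. by move=> Xx; rewrite -[x]addr0 -[x]scale1r; exact: span_cons Xx span0. Qed.

Lemma spanD x y : span X x -> span X y -> span X (x + y).
Proof.
move=> Sx Sy; move: x Sx; apply: span_ind => [|c x z Xx Sz]; first by rewrite add0r.
by rewrite -addrA; exact: span_cons.
Qed.

Lemma spanZ c x : span X x -> span X (c *: x).
Proof.
move: x; apply: span_ind => [|d x z Xx Sz]; first by rewrite scaler0; exact: span0.
by rewrite scalerDr scalerA; exact: span_cons.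
Qed.

End Span.

Lemma subalg_0 (K : fieldType) (A : algType K) (G : set A) : subalg G 0.
Proof. by have := subalg_Z 0 (@subalg_1 _ _ G); rewrite scale0r. Qed.

(** * Words, their coproducts and their commutators under an abstract skew pairing *)

Section SkewPairing.
Variables (K : fieldType) (U : algType K) (I : eqType) (L : zmodType).
Variable alpha : I -> L.

Definition word (X : I -> U) (l : seq I) : U := \prod_(j <- l) X j.

(** For the generators [uE] and [uF] this is [Uplus], respectively [Uminus_opp], by conversion. *)
Definition word_span (X : I -> U) (z : L) : set U :=
  span [set x | exists l : seq I, \sum_(j <- l) alpha j = z /\ x = word X l].

Lemma word_sub (X : I -> U) (G : set U) l :
  (forall j, subalg G (X j)) -> subalg G (word X l).
Proof.
move=> GX; elim: l => [|j l IHl]; first by rewrite /word big_nil; exact: subalg_1.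
by rewrite /word big_cons; exact: subalg_M.
Qed.

Lemma word_span_sub (X : I -> U) (G : set U) z x :
  (forall j, subalg G (X j)) -> word_span X z x -> subalg G x.
Proof.
move=> GX; move: x; apply: span_ind => [|a x x' [l [_ ->]] Bx']; first exact: subalg_0.
by apply: subalg_D Bx'; apply: subalg_Z; exact: word_sub.
Qed.

(** Expands the product of the factors $X_j \otimes 1 + W_j \otimes X_j$ as a list of pure tensors.
    This is the coproduct of a word in the $e_j$, and the opposite coproduct of a word in the
    $f_j$. *)
Fixpoint word_coproduct (X W : I -> U) (l : seq I) : seq (U * U) :=
  if l is j :: l' then
    [seq (X j * q.1, q.2) | q <- word_coproduct X W l'] ++
    [seq (W j * q.1, X j * q.2) | q <- word_coproduct X W l']
  else [:: (1, 1)].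

Lemma word_coproduct_sub (X W : I -> U) (G : set U) l q :
  (forall j, subalg G (X j)) -> (forall j, subalg G (W j)) ->
  q \in word_coproduct X W l -> subalg G q.1 /\ subalg G q.2.
Proof.
move=> GX GW; elim: l q => [|j l IHl] q /=.
  by rewrite inE => /eqP-> /=; split; exact: subalg_1.
rewrite mem_cat => /orP[] /mapP[q' /IHl[B1 B2] ->] /=.
  by split=> //; exact: subalg_M.
by split; exact: subalg_M.
Qed.

(* One half of a pairing of the Borel parts, chosen so that exchanging
   (e, omega) with (f, omega') and the two arguments of the pairing turns each
   half into the other. *)
Record skew_pairing (X W Y V : I -> U) (GX GY : set U) (c : K)
    (eps : U -> K) (P : U -> U -> K) : Prop := SkewPairing {
  skew_BX_X : forall j, subalg GX (X j);
  skew_BX_W : forall j, subalg GX (W j);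
  skew_BY_Y : forall j, subalg GY (Y j);
  skew_BY_V : forall j, subalg GY (V j);
  skew_lin : forall y a x x', subalg GY y -> subalg GX x -> subalg GX x' ->
    P y (a *: x + x') = a * P y x + P y x';
  skew_Y1 : forall i, P (Y i) 1 = 0;
  skew_V1 : forall i, P (V i) 1 = 1;
  skew_YM : forall i x x', subalg GX x -> subalg GX x' ->
    P (Y i) (x * x') = P (Y i) x * eps x' + P (V i) x * P (Y i) x';
  skew_VM : forall i x x', subalg GX x -> subalg GX x' ->
    P (V i) (x * x') = P (V i) x * P (V i) x';
  skew_mul_word : forall y y' l, subalg GY y -> subalg GY y' ->
    P (y * y') (word X l) =
    \sum_(q <- word_coproduct X W l) P y q.1 * P y' q.2;
  skew_YX : forall i j, P (Y i) (X j) = (i == j)%:R * c;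
  skew_YW : forall i j, P (Y i) (W j) = 0;
  skew_VX : forall i j, P (V i) (X j) = 0;
  skew_eps1 : eps 1 = 1;
  skew_epsM : forall x x', eps (x * x') = eps x * eps x';
  skew_epsX : forall j, eps (X j) = 0;
  skew_epsW : forall j, eps (W j) = 1;
  skew_XV : forall i j, X j * V i = P (V i) (W j) *: (V i * X j);
  skew_WX : forall i j, exists a, W i * X j = a *: (X j * W i);
  skew_comm : forall i j,
    X j * Y i - Y i * X j = - ((i == j)%:R * c) *: (W i - V i)
}.

Section Theory.
Variables (X W Y V : I -> U) (GX GY : set U) (c : K) (eps : U -> K).
Variable P : U -> U -> K.
Hypothesis HP : skew_pairing X W Y V GX GY c eps P.

Local Notation cop := (word_coproduct X W).

Local Notation BX := (subalg GX).
Local Notation BY := (subalg GY).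

Let P0 y : BY y -> P y 0 = 0.
Proof.
move=> By; have := skew_lin HP (-1) By (subalg_0 GX) (subalg_0 GX).
by rewrite scaler0 addr0 mulN1r addNr.
Qed.

Let PZ y a x : BY y -> BX x -> P y (a *: x) = a * P y x.
Proof. by move=> By Bx; rewrite -[a *: x]addr0 (skew_lin HP a By Bx (subalg_0 GX)) P0 // addr0. Qed.

Lemma skew_pairing_sum (J : eqType) y (l : seq J) (a : J -> K) (x : J -> U) :
  BY y -> (forall q, q \in l -> BX (x q)) ->
  P y (\sum_(q <- l) a q *: x q) = \sum_(q <- l) a q * P y (x q).
Proof.
(* Additivity of [P y] is available only inside [BX], so membership of the partial sums is carried
   through the induction. *)
move=> By Bl; suff [] : BX (\sum_(q <- l) a q *: x q) /\
  P y (\sum_(q <- l) a q *: x q) = \sum_(q <- l) a q * P y (x q) by [].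
elim: l Bl => [|q l IHl] Bl; first by rewrite !big_nil P0 //; split=> //; exact: subalg_0.
have [|Bs Ps] := IHl; first by move=> q' lq'; apply: Bl; rewrite inE lq' orbT.
have Bq : BX (x q) by apply: Bl; rewrite mem_head.
rewrite !big_cons (skew_lin HP) // Ps; split=> //.
exact: (subalg_D (subalg_Z _ Bq) Bs).
Qed.

Let cop_sub l q : q \in cop l -> BX q.1 /\ BX q.2.
Proof. by apply: word_coproduct_sub; case: HP. Qed.

(** Contractions of one leg of the coproduct of a word with a functional. For [phi = P (Y i)] they
    are the left and right skew derivations attached to [Y i]. *)
Let contrL (phi : U -> K) l := \sum_(q <- cop l) phi q.1 *: q.2.
Let contrR (phi : U -> K) l := \sum_(q <- cop l) phi q.2 *: q.1.

Let contrL_nil phi : contrL phi [::] = phi 1 *: 1.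
Proof. by rewrite /contrL /= big_seq1. Qed.

Let contrR_nil phi : contrR phi [::] = phi 1 *: 1.
Proof. by rewrite /contrR /= big_seq1. Qed.

Let contrL_cons phi j l : contrL phi (j :: l) =
  \sum_(q <- cop l) phi (X j * q.1) *: q.2 +
  X j * \sum_(q <- cop l) phi (W j * q.1) *: q.2.
Proof.
rewrite /contrL /= big_cat !big_map /= mulr_sumr; congr (_ + _).
by apply: eq_bigr => q _; rewrite scalerAr.
Qed.

Let contrR_cons phi j l : contrR phi (j :: l) =
  X j * contrR phi l + W j * \sum_(q <- cop l) phi (X j * q.2) *: q.1.
Proof.
rewrite /contrR /= big_cat !big_map /= !mulr_sumr.
by congr (_ + _); apply: eq_bigr => q _; rewrite scalerAr.
Qed.

Let word_cons j l : word X (j :: l) = X j * word X l.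
Proof. exact: big_cons. Qed.

(** Since [eps] kills every [X j], only the term in which each letter puts its [W j] in the left leg
    survives. *)
Lemma counitL_word l : \sum_(q <- cop l) eps q.1 *: q.2 = word X l.
Proof.
rewrite -/(contrL eps l); elim: l => [|j l IHl].
  by rewrite contrL_nil (skew_eps1 HP) scale1r /word big_nil.
rewrite contrL_cons word_cons big1 ?add0r => [|q _]; last first.
  by rewrite (skew_epsM HP) (skew_epsX HP) mul0r scale0r.
rewrite -IHl; congr (_ * _); apply: eq_bigr => q _.
by rewrite (skew_epsM HP) (skew_epsW HP) mul1r.
Qed.

(** Such a functional sees only the term whose right leg is 1, and there the left leg is the whole
    word. This serves both for [eps] and for [P (V i)]. *)
Let contrR_word phi l : phi 1 = 1 ->
  (forall j x, BX x -> phi (X j * x) = 0) -> contrR phi l = word X l.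
Proof.
move=> phi1 phiX; elim: l => [|j l IHl].
  by rewrite contrR_nil phi1 scale1r /word big_nil.
rewrite contrR_cons IHl word_cons big_seq big1 ?mulr0 ?addr0 // => q lq.
by rewrite phiX ?scale0r //; case: (cop_sub lq).
Qed.

Lemma counitR_word l : \sum_(q <- cop l) eps q.2 *: q.1 = word X l.
Proof.
apply: contrR_word => [|j x _]; first exact: (skew_eps1 HP).
by rewrite (skew_epsM HP) (skew_epsX HP) mul0r.
Qed.

Let P_contrL y y' l : BY y -> BY y' ->
  P (y * y') (word X l) = P y' (contrL (P y) l).
Proof.
move=> By By'; rewrite (skew_mul_word HP) // skew_pairing_sum // => q.
by case/cop_sub.
Qed.

Let P_contrR y y' l : BY y -> BY y' ->
  P (y * y') (word X l) = P y (contrR (P y') l).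
Proof.
move=> By By'; rewrite (skew_mul_word HP) // skew_pairing_sum //.
  by apply: eq_bigr => q _; rewrite mulrC.
by move=> q /cop_sub[].
Qed.

Lemma pair_mul_grouplike i y l : BY y -> P (y * V i) (word X l) = P y (word X l).
Proof.
move=> By; rewrite P_contrR //; last exact: (skew_BY_V HP i).
rewrite contrR_word ?(skew_V1 HP) // => j x Bx.
by rewrite (skew_VM HP) ?(skew_VX HP) ?mul0r //; exact: (skew_BX_X HP j).
Qed.

Lemma word_group_comm i l : exists a, W i * word X l = a *: (word X l * W i).
Proof.
elim: l => [|j l [a IHl]]; first by exists 1; rewrite /word big_nil mulr1 mul1r scale1r.
have [b Hb] := skew_WX HP i j; exists (b * a).
by rewrite word_cons mulrA Hb -scalerAl -(mulrA (X j) (W i)) IHl -scalerAr scalerA mulrA.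
Qed.

Lemma word_span_mul j z x : word_span X z x -> word_span X (alpha j + z) (X j * x).
Proof.
move: x; apply: span_ind => [|a x x' [l [zl ->]] Sx']; first by rewrite mulr0; exact: span0.
rewrite mulrDr -scalerAr; apply: span_cons => //; exists (j :: l).
by rewrite big_cons zl word_cons.
Qed.

(** The commutator with [Y i] obeys a Leibniz rule in the first letter, and the two contractions by
    [P (Y i)] obey the same recursion. Hence the elements found in the commutator also describe
    multiplication by [Y i] under the pairing. *)
Lemma word_commutator i l : exists A B,
  [/\ word_span X (\sum_(j <- l) alpha j - alpha i) A,
      word_span X (\sum_(j <- l) alpha j - alpha i) B,
      word X l * Y i - Y i * word X l = - c *: (A * W i - V i * B),
      forall y, BY y -> P (Y i * y) (word X l) = c * P y B
    & forall y, BY y -> P (y * Y i) (word X l) = c * P y (A * W i)].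
Proof.
have BYY := skew_BY_Y HP i; have BYV := skew_BY_V HP i.
(* The two pairing formulas are replaced by identities of contractions, free of [y], on which
   induction on the word is possible. *)
suff [A [B [SA SB XY EB EA]]] : exists A B,
  [/\ word_span X (\sum_(j <- l) alpha j - alpha i) A,
      word_span X (\sum_(j <- l) alpha j - alpha i) B,
      word X l * Y i - Y i * word X l = - c *: (A * W i - V i * B),
      contrL (P (Y i)) l = c *: B
    & contrR (P (Y i)) l = c *: (A * W i)].
  have BXS z x : word_span X z x -> BX x.
    by apply: word_span_sub => j; exact: skew_BX_X HP j.
  exists A, B; split=> // y By; first by rewrite P_contrL // EB PZ //; exact: BXS SB.
  rewrite P_contrR // EA PZ //; apply: (subalg_M _ _); first exact: BXS SA.
  exact: (skew_BX_W HP i).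
elim: l => [|j l [A [B [SA SB XY EB EA]]]].
  exists 0, 0; split; rewrite ?mul0r ?mulr0 ?subrr ?scaler0; try exact: span0.
  - by rewrite /word big_nil mul1r mulr1 subrr.
  - by rewrite contrL_nil (skew_Y1 HP) scale0r.
  - by rewrite contrR_nil (skew_Y1 HP) scale0r.
have [a Wl] := word_group_comm i l.
have Sl : word_span X (\sum_(k <- j :: l) alpha k - alpha i) ((i == j)%:R *: word X l).
  case: eqP => [->|_]; last by rewrite scale0r; exact: span0.
  by rewrite scale1r; apply: span_gen; exists l; rewrite big_cons addrC addKr.
(* The terms with [i == j] come from the commutator of the new letter with [Y i]. The scalar [a]
   moves [W i] to the right of the word, and [P (V i) (W j)] moves [V i] to the left of [X j]. *)
exists (X j * A + a *: ((i == j)%:R *: word X l)),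
  ((i == j)%:R *: word X l + P (V i) (W j) *: (X j * B)); split.
- apply: spanD; last exact: spanZ.
  by rewrite big_cons -addrA; exact: word_span_mul.
- apply: spanD => //; apply: spanZ.
  by rewrite big_cons -addrA; exact: word_span_mul.
- have -> : word X (j :: l) * Y i - Y i * word X (j :: l) =
      X j * (word X l * Y i - Y i * word X l) + (X j * Y i - Y i * X j) * word X l.
    by rewrite word_cons mulrBr mulrBl !mulrA addrA subrK.
  have cE : - ((i == j)%:R * c) = - c * (i == j)%:R by rewrite mulNr mulrC.
  rewrite XY (skew_comm HP) cE -scalerAr -scalerAl -scalerA -scalerDr.
  congr (_ *: _); rewrite mulrBr mulrBl mulrDl mulrDr !mulrA (skew_XV HP) scalerBr Wl.
  rewrite opprD addrACA; congr (_ + _); first by rewrite -!scalerAl !scalerA [a * _]mulrC.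
  by rewrite addrC -!scalerAr -scalerAl mulrA.
- rewrite contrL_cons scalerDr.
  (* As [P (V i)] kills [X j], the value of [P (Y i)] on [X j * x] is $\delta_{ij}\, c$ times the
     counit of [x], and the counit contracts the coproduct back to the word. *)
  have -> : \sum_(q <- cop l) P (Y i) (X j * q.1) *: q.2 = c *: ((i == j)%:R *: word X l).
    rewrite -counitL_word !scaler_sumr big_seq [RHS]big_seq; apply: eq_bigr => q lq.
    have [Bq _] := cop_sub lq.
    rewrite (skew_YM HP) ?(skew_VX HP) ?mul0r ?addr0 //; last exact: (skew_BX_X HP j).
    by rewrite (skew_YX HP) !scalerA [c * _]mulrC.
  congr (_ + _); rewrite scalerA [c * _]mulrC -scalerA scalerAr -EB scalerAr; congr (_ * _).
  rewrite /contrL scaler_sumr big_seq [RHS]big_seq; apply: eq_bigr => q lq.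
  have [Bq _] := cop_sub lq.
  rewrite (skew_YM HP) ?(skew_YW HP) ?mul0r ?add0r //; last exact: (skew_BX_W HP j).
  by rewrite scalerA.
- rewrite contrR_cons EA mulrDl scalerDr; congr (_ + _).
    by rewrite -scalerAr mulrA.
  have -> : \sum_(q <- cop l) P (Y i) (X j * q.2) *: q.1 = c *: ((i == j)%:R *: word X l).
    rewrite -counitR_word !scaler_sumr big_seq [RHS]big_seq; apply: eq_bigr => q lq.
    have [_ Bq] := cop_sub lq.
    rewrite (skew_YM HP) ?(skew_VX HP) ?mul0r ?addr0 //; last exact: (skew_BX_X HP j).
    by rewrite (skew_YX HP) !scalerA [c * _]mulrC.
  rewrite -!scalerAr; congr (_ *: _).
  case: eqP => [<-|_]; last by rewrite !scale0r scaler0 mul0r.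
  by rewrite !scale1r -scalerAl.
Qed.

End Theory.
End SkewPairing.

(** * Dual bases and adjoint maps *)

Section DualBases.
Variables (K : fieldType) (U : algType K) (I : eqType) (L : zmodType).
Variables (alpha : I -> L) (X W Y V : I -> U) (GX GY : set U).
Variables (c : K) (eps : U -> K) (P : U -> U -> K).
Hypothesis HP : skew_pairing X W Y V GX GY c eps P.
Hypothesis HP' : skew_pairing Y V X W GY GX c eps (fun x y => P y x).

Local Notation BX := (subalg GX).
Local Notation BY := (subalg GY).
Local Notation XS := (word_span alpha X).
Local Notation YS := (word_span alpha Y).

Let XS_BX z x : XS z x -> BX x.
Proof. by apply: word_span_sub => j; exact: skew_BX_X HP j. Qed.

Let YS_BY z y : YS z y -> BY y.
Proof. by apply: word_span_sub => j; exact: skew_BX_X HP' j. Qed.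

Let P0r y : BY y -> P y 0 = 0.
Proof.
move=> By; have := skew_lin HP (-1) By (subalg_0 GX) (subalg_0 GX).
by rewrite scaler0 addr0 mulN1r addNr.
Qed.

Let P0l x : BX x -> P 0 x = 0.
Proof.
move=> Bx; have := skew_lin HP' (-1) Bx (subalg_0 GY) (subalg_0 GY).
by rewrite /= scaler0 addr0 mulN1r addNr.
Qed.

(** The right contraction produces [A * W i]; this removes the group-like factor, so that [A] itself
    is adjoint to right multiplication by [Y i]. *)
Lemma pair_span_mul_grouplike i z x y :
  BX x -> YS z y -> P y (x * W i) = P y x.
Proof.
move=> Bx Sy; have Bxw : BX (x * W i) := subalg_M Bx (skew_BX_W HP i).
suff [] : BY y /\ P y (x * W i) = P y x by [].
move: y Sy; apply: span_ind => [|a y y' [l [_ ->]] [By' IH]].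
  by split; [exact: subalg_0 | rewrite !P0l].
have By : BY (word Y l) by apply: word_sub => j; exact: skew_BX_X HP' j.
split; first exact: (subalg_D (subalg_Z _ By) By').
by rewrite !(skew_lin HP') // IH (pair_mul_grouplike HP').
Qed.

(** The two elements are packed into one pair so that the axiom of choice can turn them into
    functions of [x]. *)
Lemma word_span_commutator i z x : XS z x -> exists AB : U * U,
  [/\ XS (z - alpha i) AB.1, XS (z - alpha i) AB.2,
      x * Y i - Y i * x = - c *: (AB.1 * W i - V i * AB.2),
      forall y z', YS z' y -> P (Y i * y) x = c * P y AB.2
    & forall y z', YS z' y -> P (y * Y i) x = c * P y AB.1].
Proof.
have BYY := skew_BY_Y HP i.
move=> Sx; suff [] : BX x /\ exists AB : U * U,
  [/\ XS (z - alpha i) AB.1, XS (z - alpha i) AB.2,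
      x * Y i - Y i * x = - c *: (AB.1 * W i - V i * AB.2),
      forall y z', YS z' y -> P (Y i * y) x = c * P y AB.2
    & forall y z', YS z' y -> P (y * Y i) x = c * P y AB.1] by [].
move: x Sx; apply: span_ind => [|a x x' [l [zl ->]] [Bx' [[A' B'] [SA' SB' E' PB' PA']]]].
  split; first exact: subalg_0.
  exists (0, 0); split=> /=; try exact: span0.
  - by rewrite !mulr0 !mul0r !subrr scaler0.
  - by move=> y z' /YS_BY By; rewrite !P0r ?mulr0 //; exact: subalg_M.
  - by move=> y z' /YS_BY By; rewrite !P0r ?mulr0 //; exact: subalg_M.
have [A [B [SA SB E PB PA]]] := word_commutator alpha HP i l.
rewrite zl in SA SB.
have Bl : BX (word X l) by apply: word_sub => j; exact: skew_BX_X HP j.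
split; first exact: (subalg_D (subalg_Z _ Bl) Bx').
exists (a *: A + A', a *: B + B'); split=> /=.
- by apply: spanD => //; exact: spanZ.
- by apply: spanD => //; exact: spanZ.
- rewrite mulrDl mulrDr opprD addrACA E' -scalerAl -scalerAr -scalerBr E.
  rewrite scalerA [a * _]mulrC -scalerA -scalerDr; congr (_ *: _).
  by rewrite mulrDl mulrDr -scalerAl -scalerAr opprD addrACA scalerBr.
- move=> y z' Sy; have By := YS_BY Sy.
  have Byy : BY (Y i * y) by exact: subalg_M.
  have BB := XS_BX SB; have BB' := XS_BX SB'.
  rewrite (skew_lin HP a Byy Bl Bx') (skew_lin HP a By BB BB') (PB' _ _ Sy) PB //.
  by rewrite mulrDr mulrCA.
- move=> y z' Sy; have By := YS_BY Sy.
  have Byy : BY (y * Y i) by exact: subalg_M.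
  have BA := XS_BX SA; have BA' := XS_BX SA'.
  rewrite (skew_lin HP a Byy Bl Bx') (skew_lin HP a By BA BA') (PA' _ _ Sy) PA //.
  by rewrite (pair_span_mul_grouplike _ BA Sy) mulrDr mulrCA.
Qed.

(** The lists [C] and [C'] hold dual pairs in degrees [z] and [z - alpha i]. Adjoint maps can be
    moved across the canonical element $\sum v \otimes u$, which turns the two parts of the
    commutator into sums over [C']. Keeping [beta] an arbitrary bilinear map lets the statement be
    applied with the roles of $e$ and $f$ exchanged. *)
Lemma dual_basis_commutator (i : I) (z : L) (C C' : seq (U * U))
    (beta : U -> U -> U) :
  (forall y, linear (beta y)) -> (forall x, linear (beta^~ x)) ->
  (forall q, q \in C -> XS z q.2) ->
  (forall q, q \in C' -> YS (z - alpha i) q.1) ->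
  (forall y, YS z y -> y = \sum_(q <- C) P y q.2 *: q.1) ->
  (forall x, XS (z - alpha i) x -> x = \sum_(q <- C') P q.1 x *: q.2) ->
  \sum_(q <- C) beta q.1 (q.2 * Y i) = \sum_(q <- C) beta q.1 (Y i * q.2)
    - \sum_(q <- C') beta (q.1 * Y i) (q.2 * W i)
    + \sum_(q <- C') beta (Y i * q.1) (V i * q.2).
Proof.
move=> linr linl CX CY CC CC'.
pose br y : {linear U -> U} := HB.pack (beta y) (GRing.isLinear.Build _ _ _ _ _ (linr y)).
pose bl x : {linear U -> U} := HB.pack (beta^~ x) (GRing.isLinear.Build _ _ _ _ _ (linl x)).
have brE y x : beta y x = br y x by [].
have blE y x : beta y x = bl x y by [].
have [AB ABP] : exists AB : U -> U * U, forall x, XS z x ->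
  [/\ XS (z - alpha i) (AB x).1, XS (z - alpha i) (AB x).2,
      x * Y i - Y i * x = - c *: ((AB x).1 * W i - V i * (AB x).2),
      forall y z', YS z' y -> P (Y i * y) x = c * P y (AB x).2
    & forall y z', YS z' y -> P (y * Y i) x = c * P y (AB x).1].
  have /choice[AB ABP] x : exists AB : U * U, XS z x ->
    [/\ XS (z - alpha i) AB.1, XS (z - alpha i) AB.2,
      x * Y i - Y i * x = - c *: (AB.1 * W i - V i * AB.2),
      forall y z', YS z' y -> P (Y i * y) x = c * P y AB.2
    & forall y z', YS z' y -> P (y * Y i) x = c * P y AB.1].
    have [/(word_span_commutator i)[AB ?]|nx] := pselect (XS z x); first by exists AB.
    (* A default value outside the degree [z] part. *)
    by exists (0, 0).
  by exists AB.
have YSl y : YS (z - alpha i) y -> YS z (Y i * y).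
  by move/(word_span_mul i); rewrite addrC subrK.
have YSr y : YS (z - alpha i) y -> YS z (y * Y i).
  move: y; apply: span_ind => [|a y y' [l [zl ->]] Sy']; first by rewrite mul0r; exact: span0.
  rewrite mulrDl -scalerAl; apply: span_cons => //; exists (rcons l i).
  by rewrite /word !big_rcons /= zl subrK.
(* Both sides expand to the same double sum over [C] and [C'], by duality. *)
have transfer (h D : U -> U) (g : U -> U) : linear g ->
    (forall y, YS (z - alpha i) y -> YS z (h y)) ->
    (forall x, XS z x -> XS (z - alpha i) (D x)) ->
    (forall x y, XS z x -> YS (z - alpha i) y -> P (h y) x = c * P y (D x)) ->
    c *: \sum_(q <- C) beta q.1 (g (D q.2)) = \sum_(q <- C') beta (h q.1) (g q.2).
  move=> ling hY DX hD.
  pose lg : {linear U -> U} := HB.pack g (GRing.isLinear.Build _ _ _ _ _ ling).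
  have gE x : g x = lg x by [].
  rewrite [RHS]big_seq; under [RHS]eq_bigr => q' Cq'.
    rewrite {1}(CC _ (hY _ (CY _ Cq'))) blE linear_sum; over.
  rewrite -big_seq exchange_big /= scaler_sumr big_seq [RHS]big_seq.
  apply: eq_bigr => q Cq; rewrite {1}(CC' _ (DX _ (CX _ Cq))) gE linear_sum brE linear_sum.
  rewrite scaler_sumr big_seq [RHS]big_seq; apply: eq_bigr => q' Cq'.
  rewrite !linearZ /= (hD _ _ (CX _ Cq) (CY _ Cq')) [RHS]blE [RHS]linearZ /=.
  by rewrite scalerA [_ * c]mulrC.
(* Up to the factor [c], the first component of [AB] is adjoint to right multiplication by [Y i] and
   the second to left multiplication. *)
have EA := transfer (fun y => y * Y i) (fun x => (AB x).1) (fun x => x * W i).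
have EB := transfer (fun y => Y i * y) (fun x => (AB x).2) (fun x => V i * x).
rewrite -EA; first last.
- by move=> x y /ABP[_ _ _ _ H] Sy; exact: H Sy.
- by move=> x /ABP[].
- exact: YSr.
- by move=> a x x'; rewrite mulrDl scalerAl.
rewrite -EB; first last.
- by move=> x y /ABP[_ _ _ H _] Sy; exact: H Sy.
- by move=> x /ABP[].
- exact: YSl.
- by move=> a x x'; rewrite mulrDr scalerAr.
rewrite 2!scaler_sumr -sumrB -big_split big_seq [RHS]big_seq; apply: eq_bigr => q Cq /=.
have [_ _ /(canRL (subrK _)) -> _ _] := ABP _ (CX _ Cq).
rewrite !brE linearD linearZ /= !brE linearB scaleNr scalerBr opprB /=.
by rewrite [LHS]addrC [c *: _ - _]addrC addrA.
Qed.

End DualBases.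

(** * Relations and generators of the quantum group *)

Section Presentation.
Variables (K : fieldType) (n : nat) (r s : K).
Local Notation U := (Uq n r s).
Local Notation gen := (palg_gen (@uq_rel K n r s) : uq_gen n -> U).

(** Identifies evaluation at the generators with the quotient map, so that the relations and
    induction on terms descend to [Uq]. *)
Lemma teval_gen (x : aterm K (uq_gen n)) :
  teval (A := U) gen x = \pi_({eq_quot tcong_equiv (@uq_rel K n r s)})%qT x.
Proof.
elim: x => [g||//|x IHx y IHy|x IHx|x IHx y IHy|a x IHx] //=.
- by rewrite IHx IHy; exact: paddE.
- by rewrite IHx; exact: poppE.
- by rewrite IHx IHy; exact: pmulE.
- by rewrite IHx; exact: pscaleE.
Qed.

Lemma uq_relP x y : uq_rel r s x y -> teval (A := U) gen x = teval gen y.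
Proof. by move=> xy; rewrite !teval_gen; apply/palg_eqP; exact: tc_rel. Qed.

Lemma uq_gen_ind (Q : U -> Prop) :
  (forall g, Q (gen g)) -> Q 0 -> Q 1 ->
  (forall x y, Q x -> Q y -> Q (x + y)) -> (forall x, Q x -> Q (- x)) ->
  (forall x y, Q x -> Q y -> Q (x * y)) -> (forall c x, Q x -> Q (c *: x)) ->
  forall x, Q x.
Proof.
move=> Qg Q0 Q1 QD QN QM QZ x; rewrite -[x]cl_surj -teval_gen.
by elim: (repr _) => //= *; [exact: QD | exact: QN | exact: QM | exact: QZ].
Qed.

Lemma torus_comm g h : is_torus g -> is_torus h -> gen g * gen h = gen h * gen g.
Proof. by move=> tg th; exact: uq_relP (R1_comm r s tg th). Qed.

Lemma uA_inv d (i : 'I_n) : uA r s d i * uA r s (~~ d) i = 1.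
Proof.
have H : uA r s false i * uA r s true i = 1 := uq_relP (R1_a r s i).
by case: d => //=; rewrite -[RHS]H; exact: torus_comm.
Qed.

Lemma uB_inv d (i : 'I_n) : uB r s d i * uB r s (~~ d) i = 1.
Proof.
have H : uB r s false i * uB r s true i = 1 := uq_relP (R1_b r s i).
by case: d => //=; rewrite -[RHS]H; exact: torus_comm.
Qed.

Lemma uA_uE (i : 'I_n) (j : 'I_n.-1) : uA r s false i * uE r s j =
  r ^ ip (eps i) (alpha j) *: (uE r s j * uA r s false i).
Proof. exact: uq_relP (R2_e r s i j). Qed.

Lemma uA_uF (i : 'I_n) (j : 'I_n.-1) : uA r s false i * uF r s j =
  r ^ (- ip (eps i) (alpha j)) *: (uF r s j * uA r s false i).
Proof. exact: uq_relP (R2_f r s i j). Qed.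

Lemma uB_uE (i : 'I_n) (j : 'I_n.-1) : uB r s false i * uE r s j =
  s ^ ip (eps i) (alpha j) *: (uE r s j * uB r s false i).
Proof. exact: uq_relP (R3_e r s i j). Qed.

Lemma uB_uF (i : 'I_n) (j : 'I_n.-1) : uB r s false i * uF r s j =
  s ^ (- ip (eps i) (alpha j)) *: (uF r s j * uB r s false i).
Proof. exact: uq_relP (R3_f r s i j). Qed.

Lemma uE_uF (i j : 'I_n.-1) : uE r s i * uF r s j - uF r s j * uE r s i =
  ((i == j)%:R / (r - s)) *: (omega r s false i - omega' r s false i).
Proof. exact: uq_relP (R4 r s i j). Qed.

Lemma omega_uE (i j : 'I_n.-1) : omega r s false i * uE r s j =
  (r ^ ip (eps (lo i)) (alpha j) * s ^ ip (eps (hi i)) (alpha j)) *: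
    (uE r s j * omega r s false i).
Proof.
by rewrite /omega -mulrA uB_uE -scalerAr (mulrA (uA _ _ _ _)) uA_uE -scalerAl
  -(mulrA (uE _ _ _)) scalerA [_ * r ^ _]mulrC.
Qed.

Lemma omega_uF (i j : 'I_n.-1) : omega r s false i * uF r s j =
  (r ^ (- ip (eps (lo i)) (alpha j)) * s ^ (- ip (eps (hi i)) (alpha j))) *:
    (uF r s j * omega r s false i).
Proof.
by rewrite /omega -mulrA uB_uF -scalerAr (mulrA (uA _ _ _ _)) uA_uF -scalerAl
  -(mulrA (uF _ _ _)) scalerA [_ * r ^ _]mulrC.
Qed.

Lemma omega'_uE (i j : 'I_n.-1) : omega' r s false i * uE r s j =
  (r ^ ip (eps (hi i)) (alpha j) * s ^ ip (eps (lo i)) (alpha j)) *: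
    (uE r s j * omega' r s false i).
Proof.
by rewrite /omega' -mulrA uB_uE -scalerAr (mulrA (uA _ _ _ _)) uA_uE -scalerAl
  -(mulrA (uE _ _ _)) scalerA [_ * r ^ _]mulrC.
Qed.

Lemma omega'_uF (i j : 'I_n.-1) : omega' r s false i * uF r s j =
  (r ^ (- ip (eps (hi i)) (alpha j)) * s ^ (- ip (eps (lo i)) (alpha j))) *:
    (uF r s j * omega' r s false i).
Proof.
by rewrite /omega' -mulrA uB_uF -scalerAr (mulrA (uA _ _ _ _)) uA_uF -scalerAl
  -(mulrA (uF _ _ _)) scalerA [_ * r ^ _]mulrC.
Qed.

End Presentation.

(** * Inner products of simple roots and basis vectors *)

Section LatticeTheory.
Variable n : nat.
Implicit Types x y z : lattice n.

Lemma ip_eps i y : ip (eps i) y = y 0 i.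
Proof.
rewrite /ip (bigD1 i) //= big1 => [|k ki]; first by rewrite mxE !eqxx mul1r addr0.
by rewrite mxE (negPf ki) andbF mul0r.
Qed.

Lemma ipC x y : ip x y = ip y x.
Proof. by apply: eq_bigr => i _; rewrite mulrC. Qed.

Lemma ipDr x y z : ip x (y + z) = ip x y + ip x z.
Proof. by rewrite -big_split; apply: eq_bigr => i _; rewrite mxE mulrDr. Qed.

Lemma ipNr x y : ip x (- y) = - ip x y.
Proof. by rewrite -sumrN; apply: eq_bigr => i _; rewrite mxE mulrN. Qed.

Lemma ip_alpha (j : 'I_n.-1) y : ip (alpha j) y = y 0 (lo j) - y 0 (hi j).
Proof.
by rewrite ipC /alpha ipDr ipNr ![ip y _]ipC !ip_eps.
Qed.

(** Both sides are $\delta_{i,j}-\delta_{i+1,j}$. This reconciles [pair_ww], whose exponents involve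
    $\alpha_i$, with the commutation of $\omega'_i$ and $e_j$, whose exponents involve
    $\alpha_j$. *)
Lemma ip_eps_alpha_lo (i j : 'I_n.-1) :
  ip (eps (lo j)) (alpha i) = - ip (eps (hi i)) (alpha j).
Proof.
rewrite !ip_eps !mxE !eqxx /= -!val_eqE /= opprB eqSS.
by rewrite [X in _ = _ - X]/= [(i.+1 == j)%N]eq_sym; congr (_ - _); rewrite eq_sym.
Qed.

Lemma ip_eps_alpha_hi (i j : 'I_n.-1) :
  ip (eps (hi j)) (alpha i) = - ip (eps (lo i)) (alpha j).
Proof. by rewrite [in RHS]ip_eps_alpha_lo opprK. Qed.

End LatticeTheory.

(** * The Hopf pairing as a couple of mirror skew pairings *)

Section HopfPairing.
Variables (K : fieldType) (n : nat) (r s : K).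
Hypotheses (hr : r != 0) (hs : s != 0).
Variables (Delta : {lrmorphism Uq n r s -> Uq2 n r s})
  (S : {linear Uq n r s -> Uq n r s}).
Hypothesis hHopf : is_hopf Delta S.
Variable p : Uq n r s -> Uq n r s -> K.
Hypothesis hp : is_hopf_pairing Delta p.

Local Notation U := (Uq n r s).
Local Notation E := (@uE K n r s).
Local Notation F := (@uF K n r s).
Local Notation om := (@omega K n r s false).
Local Notation om' := (@omega' K n r s false).

Lemma tensM (a a' b b' : U) : tens (a * a') (b * b') = tens a b * tens a' b'.
Proof.
rewrite [RHS]pmulE; apply/palg_eqP; apply: tc_rel; exact: tens_M.
Qed.

Lemma tens11 : tens (1 : U) (1 : U) = 1.
Proof. by apply/palg_eqP; apply: tc_rel; exact: tens_1. Qed.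

Lemma comul_omega j : Delta (om j) = tens (om j) (om j).
Proof. by rewrite /omega /omega' rmorphM /= (comul_A hHopf) (comul_B hHopf) -tensM. Qed.

Lemma comul_omega' j : Delta (om' j) = tens (om' j) (om' j).
Proof. by rewrite /omega /omega' rmorphM /= (comul_A hHopf) (comul_B hHopf) -tensM. Qed.

Lemma comul_wordE l :
  Delta (word E l) = \sum_(q <- word_coproduct E om l) tens q.1 q.2.
Proof.
elim: l => [|j l IHl]; first by rewrite /word big_nil rmorph1 big_seq1 tens11.
rewrite /word big_cons -/(word E l) rmorphM /= IHl (comul_E hHopf) mulrDl /= big_cat !big_map /=.
rewrite !mulr_sumr; congr (_ + _); apply: eq_bigr => q _; rewrite -tensM //.
by rewrite mul1r.
Qed.

(** With the legs exchanged, the coproduct of $f_j$ takes the form $f_j \otimes 1 + \omega'_j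
    \otimes f_j$ expected by [word_coproduct]. *)
Lemma comul_wordF l :
  Delta (word F l) = \sum_(q <- word_coproduct F om' l) tens q.2 q.1.
Proof.
elim: l => [|j l IHl]; first by rewrite /word big_nil rmorph1 big_seq1 tens11.
rewrite /word big_cons -/(word F l) rmorphM /= IHl (comul_F hHopf) mulrDl /= big_cat !big_map /=.
rewrite !mulr_sumr; congr (_ + _); apply: eq_bigr => q _; rewrite -tensM //.
by rewrite mul1r.
Qed.

Local Notation Bpr := (@Bp K n r s).
Local Notation Bmr := (@Bm K n r s).

Lemma Bp_E j : Bpr (E j). Proof. by apply: subalg_gen; constructor; exists j. Qed.
Lemma Bp_omega j : Bpr (om j).
Proof. by apply: subalg_gen; constructor 2; exists false, j. Qed.
Lemma Bm_F j : Bmr (F j). Proof. by apply: subalg_gen; constructor; exists j. Qed.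
Lemma Bm_omega' j : Bmr (om' j).
Proof. by apply: subalg_gen; constructor 2; exists false, j. Qed.

Lemma counit1 : counit (1 : U) = 1.
Proof. exact: (palg_lift1 (@counit_rel K n r s)). Qed.
Lemma counitM (x y : U) : counit (x * y) = counit x * counit y.
Proof. exact: (palg_liftM (@counit_rel K n r s)). Qed.
Lemma counit_E j : counit (E j) = 0.
Proof. exact: (palg_lift_gen (@counit_rel K n r s)). Qed.
Lemma counit_F j : counit (F j) = 0.
Proof. exact: (palg_lift_gen (@counit_rel K n r s)). Qed.
Lemma counit_omega j : counit (om j) = 1.
Proof.
by rewrite counitM /counit !(palg_lift_gen (@counit_rel K n r s)) mul1r.
Qed.
Lemma counit_omega' j : counit (om' j) = 1.
Proof.
by rewrite counitM /counit !(palg_lift_gen (@counit_rel K n r s)) mul1r.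
Qed.

Lemma pairing_EF : skew_pairing E om F om'
  [set x | [\/ exists j, x = uE r s j, exists d j, x = omega r s d j
             | exists d (i : 'I_n), i.+1 = n /\ x = uA r s d i]]
  [set x | [\/ exists j, x = uF r s j, exists d j, x = omega' r s d j
             | exists d (i : 'I_n), i.+1 = n /\ x = uB r s d i]]
  (s - r)^-1 (@counit K n r s) p.
Proof.
split.
- exact: Bp_E.
- exact: Bp_omega.
- exact: Bm_F.
- exact: Bm_omega'.
- by move=> y a x x' By Bx Bx'; exact: (pair_linearr hp).
- by move=> i; rewrite (pair_1r hp) ?counit_F //; exact: Bm_F.
- by move=> i; rewrite (pair_1r hp) ?counit_omega' //; exact: Bm_omega'.
- move=> i x x' Bx Bx'; have BF := Bm_F i; have Bw := Bm_omega' i.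
  (* The exchange of legs in [pair_mulr] yields the term $(f_i, x)\,\varepsilon(x')$ first and
     $(\omega'_i, x)(f_i, x')$ second. *)
  rewrite (pair_mulr hp (l := [:: (1, F i); (F i, om' i)])) //.
  + by rewrite !big_cons big_nil addr0 (pair_1l hp).
  + by move=> q; rewrite !inE => /orP[]/eqP-> //=; split=> //; exact: subalg_1.
  + by rewrite !big_cons big_nil addr0 (comul_F hHopf).
- move=> i x x' Bx Bx'; have Bw := Bm_omega' i.
  rewrite (pair_mulr hp (l := [:: (om' i, om' i)])) //.
  + by rewrite big_seq1.
  + by move=> q; rewrite !inE => /eqP->.
  + by rewrite big_seq1 comul_omega'.
- move=> y y' l By By'; have Bl : Bpr (word E l).
    by apply: word_sub; exact: Bp_E.
  apply: (pair_mull hp) => //; last exact: comul_wordE.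
  by move=> q; apply: word_coproduct_sub; [exact: Bp_E | exact: Bp_omega].
- exact: (pair_FE hp).
- exact: (pair_Fw hp).
- exact: (pair_wE hp).
- exact: counit1.
- exact: counitM.
- exact: counit_E.
- exact: counit_omega.
(* The value $(\omega'_i, \omega_j)$ is the inverse of the scalar by which $\omega'_i$ commutes past
   $e_j$. *)
- move=> i j; rewrite omega'_uE (pair_ww hp) addn0 expr0 expr1z scalerA.
  rewrite (ip_eps_alpha_lo i j) (ip_eps_alpha_hi i j) mulrACA -!expfzDr //.
  by rewrite !addNr !expr0z mulr1 scale1r.
- by move=> i j; rewrite omega_uE; eexists.
(* The denominator is $r-s$ in R4 and $s-r$ in the pairing, whence the minus sign in [skew_comm]. *)
- move=> i j; rewrite uE_uF eq_sym -[r - s]opprB invrN mulrN.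
  by case: eqP => [->|_] //; rewrite !mul0r oppr0 !scale0r.
Qed.

Lemma pairing_FE : skew_pairing F om' E om
  [set x | [\/ exists j, x = uF r s j, exists d j, x = omega' r s d j
             | exists d (i : 'I_n), i.+1 = n /\ x = uB r s d i]]
  [set x | [\/ exists j, x = uE r s j, exists d j, x = omega r s d j
             | exists d (i : 'I_n), i.+1 = n /\ x = uA r s d i]]
  (s - r)^-1 (@counit K n r s) (fun x y => p y x).
Proof.
split.
- exact: Bm_F.
- exact: Bm_omega'.
- exact: Bp_E.
- exact: Bp_omega.
- by move=> y a x x' By Bx Bx'; exact: (pair_linearl hp).
- by move=> i; rewrite (pair_1l hp) ?counit_E //; exact: Bp_E.
- by move=> i; rewrite (pair_1l hp) ?counit_omega //; exact: Bp_omega.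
- move=> i x x' Bx Bx'; have BE := Bp_E i; have Bw := Bp_omega i.
  rewrite (pair_mull hp (l := [:: (E i, 1); (om i, E i)])) //.
  + by rewrite !big_cons big_nil addr0 (pair_1r hp).
  + by move=> q; rewrite !inE => /orP[]/eqP-> //=; split=> //; exact: subalg_1.
  + by rewrite !big_cons big_nil addr0 (comul_E hHopf).
- move=> i x x' Bx Bx'; have Bw := Bp_omega i.
  rewrite (pair_mull hp (l := [:: (om i, om i)])) //.
  + by rewrite big_seq1.
  + by move=> q; rewrite !inE => /eqP->.
  + by rewrite big_seq1 comul_omega.
- move=> y y' l By By'; have Bl : Bmr (word F l).
    by apply: word_sub; exact: Bm_F.
  rewrite (pair_mulr hp (l := [seq (q.2, q.1) | q <- word_coproduct F om' l])) //.
  + by rewrite big_map.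
  + move=> q /mapP[q' lq' ->] /=.
    by have [] := word_coproduct_sub Bm_F Bm_omega' lq'.
  + by rewrite big_map comul_wordF.
- by move=> i j; rewrite (pair_FE hp) eq_sym.
- by move=> i j; exact: (pair_wE hp).
- by move=> i j; exact: (pair_Fw hp).
- exact: counit1.
- exact: counitM.
- exact: counit_F.
- exact: counit_omega'.
- move=> i j; rewrite omega_uF (pair_ww hp) addn0 expr0 expr1z scalerA mulrACA.
  by rewrite -!expfzDr // !subrr !expr0z mulr1 scale1r.
- by move=> i j; rewrite omega'_uF; eexists.
- move=> i j; rewrite -opprB uE_uF -scalerN opprB -[r - s]opprB invrN mulrN.
  by case: eqP => [->|_] //; rewrite !mul0r oppr0 !scale0r.
Qed.

End HopfPairing.

(** * The positive cone and the shift by the sum of positive roots *)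

Section QplusTheory.
Variable n : nat.
Implicit Types x y z : lattice n.

Lemma Qplus_word (l : seq 'I_n.-1) : Qplus n (\sum_(j <- l) alpha j).
Proof.
elim: l => [|j l [c Hc]].
  by exists (fun=> 0%N); rewrite big_nil big1.
exists (fun k => (k == j) + c k)%N; rewrite big_cons Hc.
under [RHS]eq_bigr do rewrite mulrnDr.
rewrite big_split /= [X in _ = X + _](bigD1 j) //= eqxx mulr1n [X in _ = _ + X + _]big1 ?addr0 //.
by move=> k /negPf->; rewrite mulr0n.
Qed.

Lemma ip_two_rho_alpha (j : 'I_n.-1) : ip (two_rho n) (alpha j) = 2.
Proof.
by rewrite ipC ip_alpha !mxE /=; lia.
Qed.

Lemma ip_alpha_alpha (j : 'I_n.-1) : ip (alpha j) (alpha j) = 2.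
Proof.
rewrite ip_alpha !mxE !eqxx /= -!val_eqE /= (gtn_eqF (ltnSn j)) (ltn_eqF (ltnSn j)).
by [].
Qed.

Lemma ipDl x y z : ip (x + y) z = ip x z + ip y z.
Proof. by rewrite ![ip _ z]ipC ipDr. Qed.

(** The extra terms are $2\langle\lambda,\alpha_j\rangle$ and $\langle\alpha_j,\alpha_j\rangle +
    \langle 2\rho,\alpha_j\rangle = 4 = 2\langle\alpha_j,\alpha_j\rangle$. *)
Lemma ip_shift (la : lattice n) (j : 'I_n.-1) :
  ip (la + alpha j + two_rho n) (la + alpha j) =
  ip (la + two_rho n) la + 2 * ip (la + alpha j) (alpha j).
Proof.
move: (ip_two_rho_alpha j) (ip_alpha_alpha j); move: (alpha j) => a rho_a a_a.
rewrite !(ipDr, ipDl) rho_a a_a [ip a la]ipC.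
by ring.
Qed.

Lemma ip_two_rho_comb (c : 'I_n.-1 -> nat) :
  ip (two_rho n) (\sum_j alpha j *+ c j) = (2 * \sum_j c j)%N.
Proof.
elim/big_ind2: _ => [|x a y b Hx Hy|j _].
- by rewrite /ip big1 // => i _; rewrite !mxE mulr0.
- by rewrite ipDr Hx Hy mulnDr.
elim: (c j) => [|k IH]; first by rewrite mulr0n /ip big1 // => i _; rewrite !mxE mulr0.
by rewrite mulrS ipDr IH ip_two_rho_alpha mulnS.
Qed.

(** On the cone, pairing with $2\rho$ gives twice the height. The height of [z] is thus bounded in
    terms of [nu], which leaves finitely many coefficient families. *)
Lemma finite_Qplus_interval (nu : lattice n) :
  finite_set [set z | Qplus n z /\ Qplus n (nu - z)]%classic.
Proof.
pose N := `|ip (two_rho n) nu|%N.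
pose f (c : {ffun 'I_n.-1 -> 'I_N.+1}) : lattice n := \sum_j alpha j *+ c j.
apply: (@sub_finite_set _ _ [set f c | c in [set: {ffun 'I_n.-1 -> 'I_N.+1}]]%classic); last first.
  exact/finite_image/finite_finset.
move=> z [[c zc] [c' zc']].
have cN : (2 * \sum_j c j + 2 * \sum_j c' j = N)%N.
  by rewrite /N -[nu](subrK z) addrC ipDr zc' zc !ip_two_rho_comb -PoszD absz_nat.
exists [ffun j => inord (c j)] => //; rewrite /f zc; apply: eq_bigr => j _.
rewrite ffunE inordK // ltnS -cN (bigD1 j) //=; lia.
Qed.

End QplusTheory.

(** * Finitely supported sums over a whole type *)

Lemma fsbig_setTE (T : choiceType) (V : zmodType) (A : set T) (f : T -> V) : finite_set A ->
  (forall z, f z != 0 -> A z) ->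
  \sum_(z \in [set: T]) f z = \sum_(z <- finmap.enum_fset (fset_set A)) f z.
Proof.
move=> finA fA; rewrite -fsbig_finite //; apply/esym/fsbig_widen => //.
by move=> z [_ nAz] /=; apply/eqP; apply: contra_notT nAz; exact: fA.
Qed.

Section FiniteSums.
Variables (T : choiceType) (V : zmodType).
Implicit Types (f g : T -> V).

Definition finsupp f := finite_set [set z | f z != 0]%classic.

Lemma finsupp_add f g : finsupp f -> finsupp g -> finsupp (fun z => f z + g z).
Proof.
move=> ff fg; apply: (@sub_finite_set _ _ ([set z | f z != 0] `|` [set z | g z != 0])%classic).
  move=> z /=; have [->|] := eqVneq (f z) 0; last by left.
  by rewrite add0r; right.
by rewrite finite_setU.
Qed.

Lemma finsupp_morph (W : zmodType) (h : {additive V -> W}) f :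
  finsupp f -> finite_set [set z | h (f z) != 0]%classic.
Proof.
apply: sub_finite_set => z /=.
by apply: contra_neq => ->; rewrite raddf0.
Qed.

Lemma fsbig_setTD f g : finsupp f -> finsupp g ->
  \sum_(z \in [set: T]) (f z + g z) =
  \sum_(z \in [set: T]) f z + \sum_(z \in [set: T]) g z.
Proof.
move=> ff fg; pose A := ([set z | f z != 0] `|` [set z | g z != 0])%classic.
have fA : finite_set A by rewrite finite_setU.
rewrite !(@fsbig_setTE _ _ A) ?big_split // => z; [by right|by left|].
have [->|nz _] := eqVneq (f z) 0; last by left.
by rewrite add0r; right.
Qed.

Lemma fsbig_setT_morph (W : zmodType) (h : {additive V -> W}) f : finsupp f ->
  h (\sum_(z \in [set: T]) f z) = \sum_(z \in [set: T]) h (f z).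
Proof.
move=> ff; pose A := [set z | f z != 0]%classic.
rewrite (@fsbig_setTE _ _ A f) // (@fsbig_setTE _ _ A (h \o f)) //; first exact: raddf_sum.
by move=> z; apply: contra_neq => /= ->; rewrite raddf0.
Qed.

End FiniteSums.

Lemma finsupp_shift (T : zmodType) (V : zmodType) (f : T -> V) (a : T) :
  finsupp f -> finsupp (fun z => f (z - a)).
Proof.
move=> ff; apply: (@finite_preimage _ _ [set z | f z != 0]%classic (fun z => z - a)) => //.
by move=> x y _ _; exact: addIr.
Qed.

Lemma fsbig_shift (T : zmodType) (V : zmodType) (f : T -> V) (a : T) :
  \sum_(z \in [set: T]) f (z - a) = \sum_(z \in [set: T]) f z.
Proof.
rewrite [RHS](reindex_fsbigT (fun z => z - a)) //.
by exists (fun z => z + a) => z; rewrite ?subrK ?addrK.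
Qed.

(** * Weight modules over an abstract algebra *)

Section WeightModules.
Variables (K : fieldType) (n : nat) (r s : K) (U : algType K).

(** The relations R1 to R3, which govern weights; R4 enters later through [skew_comm]. *)
Record gl_generators (A B : bool -> 'I_n -> U) (E F : 'I_n.-1 -> U) : Prop :=
  GlGenerators {
  gen_AA : forall d d' i j, A d i * A d' j = A d' j * A d i;
  gen_AB : forall d d' i j, A d i * B d' j = B d' j * A d i;
  gen_BB : forall d d' i j, B d i * B d' j = B d' j * B d i;
  gen_Ainv : forall d i, A d i * A (~~ d) i = 1;
  gen_Binv : forall d i, B d i * B (~~ d) i = 1;
  gen_AE : forall i j,
    A false i * E j = r ^ ip (eps i) (alpha j) *: (E j * A false i);
  gen_AF : forall i j,
    A false i * F j = r ^ (- ip (eps i) (alpha j)) *: (F j * A false i);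
  gen_BE : forall i j,
    B false i * E j = s ^ ip (eps i) (alpha j) *: (E j * B false i);
  gen_BF : forall i j,
    B false i * F j = s ^ (- ip (eps i) (alpha j)) *: (F j * B false i)
}.

Hypotheses (hr : r != 0) (hs : s != 0).
Variables (A B : bool -> 'I_n -> U) (E F : 'I_n.-1 -> U).
Hypothesis HG : gl_generators A B E F.
Local Notation om d j := (A d (lo j) * B d (hi j)).
Local Notation om' d j := (A d (hi j) * B d (lo j)).
Variable M : lmodType U.

(** At the generators of [Uq] this is [weight_space] by conversion. *)
Definition weight_vectors (la : lattice n) : set M :=
  [set m | forall i, A false i *: m = (r ^ ip (eps i) la)%:A *: m /\
                     B false i *: m = (s ^ ip (eps i) la)%:A *: m].
Local Notation ws := weight_vectors.

Lemma scale_algl (c : K) (x : U) (m : M) : (c *: x) *: m = c%:A *: (x *: m).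
Proof. by rewrite scalerA mulr_algl. Qed.

Lemma scale_algC (c : K) (x : U) (m : M) : x *: (c%:A *: m) = c%:A *: (x *: m).
Proof. by rewrite !scalerA mulr_algl mulr_algr. Qed.

Lemma scale_algM (c c' : K) (m : M) : c%:A *: (c'%:A *: m) = (c * c')%:A *: m.
Proof. by rewrite scalerA mulr_algl scalerA. Qed.

Lemma weight_space0 la : ws la 0.
Proof. by move=> i; rewrite !scaler0. Qed.

Lemma weight_spaceD la m m' : ws la m -> ws la m' -> ws la (m + m').
Proof.
move=> wm wm' i; have [a b] := wm i; have [a' b'] := wm' i.
by rewrite !scalerDr a b a' b'.
Qed.

Lemma weight_spaceZ la (c : K) m : ws la m -> ws la (c%:A *: m).
Proof.
move=> wm i; have [a b] := wm i.
by split; rewrite scale_algC ?a ?b !scale_algM mulrC.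
Qed.

Lemma weight_space_shift (x : U) (a la : lattice n) m :
  (forall i, A false i * x = r ^ ip (eps i) a *: (x * A false i)) ->
  (forall i, B false i * x = s ^ ip (eps i) a *: (x * B false i)) ->
  ws la m -> ws (la + a) (x *: m).
Proof.
move=> Ax Bx wm i; have [Am Bm] := wm i.
by rewrite ipDr addrC !expfzDr //; split;
  rewrite scalerA ?Ax ?Bx scale_algl -scalerA ?Am ?Bm scale_algC scale_algM.
Qed.

Lemma weight_space_E la j m : ws la m -> ws (la + alpha j) (E j *: m).
Proof. by apply: weight_space_shift => i; [exact: (gen_AE HG) | exact: (gen_BE HG)]. Qed.

Lemma weight_space_F la j m : ws la m -> ws (la - alpha j) (F j *: m).
Proof.
by apply: weight_space_shift => i; rewrite ipNr; [exact: (gen_AF HG) | exact: (gen_BF HG)].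
Qed.

Lemma weight_space_comm (x : U) la m :
  (forall i, A false i * x = x * A false i) ->
  (forall i, B false i * x = x * B false i) -> ws la m -> ws la (x *: m).
Proof.
move=> Ax Bx wm; rewrite -[la]addr0; apply: weight_space_shift wm => i.
  by rewrite Ax ip_eps mxE expr0z scale1r.
by rewrite Bx ip_eps mxE expr0z scale1r.
Qed.

Lemma weight_space_A la d i m : ws la m ->
  A d i *: m = ((r ^ ip (eps i) la) ^ ((-1) ^+ d))%:A *: m.
Proof.
move=> wm; have [Am _] := wm i; case: d; last by rewrite expr0 expr1z.
have nz : r ^ ip (eps i) la != 0 by rewrite expfz_neq0.
have {2}-> : m = (r ^ ip (eps i) la)%:A *: (A true i *: m).
  by rewrite -scale_algC -Am scalerA (gen_Ainv HG true i) scale1r.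
by rewrite expr1 exprN1 scale_algM mulVf // !scale1r.
Qed.

Lemma weight_space_B la d i m : ws la m ->
  B d i *: m = ((s ^ ip (eps i) la) ^ ((-1) ^+ d))%:A *: m.
Proof.
move=> wm; have [_ Bm] := wm i; case: d; last by rewrite expr0 expr1z.
have nz : s ^ ip (eps i) la != 0 by rewrite expfz_neq0.
have {2}-> : m = (s ^ ip (eps i) la)%:A *: (B true i *: m).
  by rewrite -scale_algC -Bm scalerA (gen_Binv HG true i) scale1r.
by rewrite expr1 exprN1 scale_algM mulVf // !scale1r.
Qed.

(** In $\omega_j \omega_j'^{-1}$ the factor $a_j a_{j+1}^{-1}$ acts by
    $r^{\langle\lambda,\alpha_j\rangle}$ and $b_{j+1} b_j^{-1}$ by
    $s^{-\langle\lambda,\alpha_j\rangle}$. *)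
Lemma weight_space_omega_ratio la j m : ws la m ->
  om false j *: (om' true j *: m) = ((r / s) ^ ip la (alpha j))%:A *: m.
Proof.
move=> wm; rewrite -!scalerA.
have wA d i := weight_space_A d i wm; have wB d i := weight_space_B d i wm.
rewrite wB !(scale_algC _ (A _ _)) !(scale_algC _ (B _ _)) wA.
rewrite !(scale_algC _ (A _ _)) !(scale_algC _ (B _ _)) wB.
rewrite !(scale_algC _ (A _ _)) wA !scale_algM.
congr (_%:A *: _); rewrite !ip_eps expr0 !expr1z expr1 !exprN1 ipC ip_alpha.
rewrite expfzDr ?mulf_neq0 ?invr_eq0 // -invr_expz !expfzMl !exprz_inv invfM.
by rewrite -!invr_expz invrK; ring.
Qed.

Lemma weight_span_E z x la m : word_span (@alpha n) E z x -> ws la m -> ws (la + z) (x *: m).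
Proof.
move=> Sx wm; move: x Sx; apply: span_ind => [|c x y [l [<- ->]] wy].
  by rewrite scale0r; exact: weight_space0.
rewrite scalerDl scale_algl; apply: weight_spaceD wy; apply: weight_spaceZ.
elim: l => [|j l IHl]; first by rewrite /word !big_nil scale1r addr0.
by rewrite /word !big_cons -/(word _ _) -scalerA addrCA addrC; exact: weight_space_E.
Qed.

(** * The antipode and the weights of modules in category O *)

Variable S : {linear U -> U}.
Hypothesis S1 : S 1 = 1.
Hypothesis SM : forall x y, S (x * y) = S y * S x.
Hypothesis SA : forall d i, S (A d i) = A (~~ d) i.
Hypothesis SB : forall d i, S (B d i) = B (~~ d) i.
Hypothesis SE : forall j, S (E j) = - (om true j * E j).
Hypothesis SF : forall j, S (F j) = - (F j * om' true j).

(** Each $S(f_j)$ differs from $f_j$ by a sign and a torus factor, and the torus preserves weight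
    spaces. *)
Lemma weight_span_SF z y la m :
  word_span (@alpha n) F z y -> ws la m -> ws (la - z) (S y *: m).
Proof.
move=> Sy wm; move: y Sy; apply: span_ind => [|c x y [l [<- ->]] wy].
  by rewrite linear0 scale0r; exact: weight_space0.
rewrite linearD linearZ /= scalerDl scale_algl; apply: weight_spaceD wy.
apply: weight_spaceZ; elim: l la m wm => [|j l IHl] la m wm.
  by rewrite /word !big_nil S1 scale1r subr0.
rewrite /word !big_cons -/(word _ _) SM -scalerA opprD addrA; apply: IHl.
rewrite SF -[- (F j * _)]scaleN1r scale_algl -scalerA; apply: weight_spaceZ.
apply: weight_space_F; apply: weight_space_comm wm => i.
  by rewrite mulrA (gen_AA HG) -mulrA (gen_AB HG) mulrA.
by rewrite mulrA -(gen_AB HG) -mulrA (gen_BB HG) mulrA.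
Qed.

Definition is_weight (la : lattice n) : Prop := exists m, ws la m /\ m <> 0.
Hypothesis M_sum : forall m : M, exists (l : seq (lattice n)) (x : lattice n -> M),
  (forall la, la \in l -> ws la (x la)) /\ m = \sum_(la <- l) x la.
Hypothesis M_bounded : exists Fs : seq (lattice n), forall la, is_weight la ->
  exists mu z, [/\ mu \in Fs, Qplus n z & la = mu - z].

(** Writing $\lambda + z = \mu - y$ with $\mu$ one of finitely many bounds places [z] in the
    interval from 0 to $\mu - \lambda$ of the cone. *)
Lemma finite_weights_above la :
  finite_set [set z | Qplus n z /\ is_weight (la + z)]%classic.
Proof.
have [Fs HF] := M_bounded.
apply: (@sub_finite_set _ _ (\bigcup_(mu in [set` Fs])
    [set z | Qplus n z /\ Qplus n (mu - la - z)])%classic).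
  move=> z [Qz /HF[mu [y [Fmu Qy Ey]]]]; exists mu => //; split=> //.
  by rewrite -addrA -opprD Ey opprB addrC subrK.
by apply: bigcup_finite => [|mu _]; [exact: finite_seq | exact: finite_Qplus_interval].
Qed.

Lemma weight_vectors_ind (Q : M -> Prop) : Q 0 -> (forall m m', Q m -> Q m' -> Q (m + m')) ->
  (forall la m, ws la m -> Q m) -> forall m, Q m.
Proof.
move=> Q0 QD Qws m; have [l [x [xl ->]]] := M_sum m.
rewrite big_seq; elim/big_ind: _ => // la /xl; exact: Qws.
Qed.

Variables (GX GY : set U) (c : K) (eta : U -> K) (p : U -> U -> K).
Hypothesis HP : skew_pairing E (fun j => om false j) F (fun j => om' false j) GX GY c eta p.
Hypothesis HP' : skew_pairing F (fun j => om' false j) E (fun j => om false j) GY GX c eta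
  (fun x y => p y x).
Variables (d : lattice n -> nat) (u v : forall z : lattice n, 'I_(d z) -> U).
Hypothesis hu : forall z, Qplus n z -> is_basis (word_span (@alpha n) E z) (@u z).
Hypothesis hv : forall z, Qplus n z -> is_basis (word_span (@alpha n) F z) (@v z).
Hypothesis hvu : forall z, Qplus n z -> forall k l, p (@v z k) (@u z l) = (k == l)%:R.

Local Notation ES := (word_span (@alpha n) E).
Local Notation FS := (word_span (@alpha n) F).

(** Empty outside the cone, so that degree [z - alpha i] makes sense for every [z]. *)
Definition dual_pairs (z : lattice n) : seq (U * U) :=
  if `[< Qplus n z >] then [seq (@v z k, @u z k) | k <- index_enum 'I_(d z)] else [::].
Local Notation C := dual_pairs.

Lemma word_span_out (X : 'I_n.-1 -> U) z x : ~ Qplus n z -> word_span (@alpha n) X z x -> x = 0.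
Proof.
move=> nQ; move: x; apply: span_ind => // a x y [l [zl _]] _.
by case: nQ; rewrite -zl; exact: Qplus_word.
Qed.

Lemma dual_pairs_sub z q : q \in C z -> FS z q.1 /\ ES z q.2.
Proof.
rewrite /C; case: asboolP => // Qz /mapP[k _ ->] /=.
by have [Hu _ _] := hu Qz; have [Hv _ _] := hv Qz.
Qed.

Lemma dual_pairs_E z x : ES z x -> x = \sum_(q <- C z) p q.1 x *: q.2.
Proof.
rewrite /C; case: asboolP => [Qz Sx|nQ /(word_span_out nQ)->]; last by rewrite big_nil.
rewrite big_map; have [Hu Su _] := hu Qz; have [Hv _ _] := hv Qz.
have [a xE] := Su x Sx; rewrite {1}xE; apply: eq_bigr => k _; congr (_ *: _).
rewrite xE (skew_pairing_sum HP) => [|| l _]; last exact: (word_span_sub (skew_BX_X HP) (Hu l)).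
  rewrite (bigD1 k) //= (hvu Qz) eqxx mulr1 big1 ?addr0 // => l lk.
  by rewrite (hvu Qz) eq_sym (negPf lk) mulr0.
exact: (word_span_sub (skew_BX_X HP') (Hv k)).
Qed.

Lemma dual_pairs_F z y : FS z y -> y = \sum_(q <- C z) p y q.2 *: q.1.
Proof.
rewrite /C; case: asboolP => [Qz Sy|nQ /(word_span_out nQ)->]; last by rewrite big_nil.
rewrite big_map; have [Hu _ _] := hu Qz; have [Hv Sv _] := hv Qz.
have [a yE] := Sv y Sy; rewrite {1}yE; apply: eq_bigr => k _; congr (_ *: _).
rewrite yE (skew_pairing_sum HP') => [|| l _]; last exact: (word_span_sub (skew_BX_X HP') (Hv l)).
  rewrite (bigD1 k) //= (hvu Qz) eqxx mulr1 big1 ?addr0 // => l lk.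
  by rewrite (hvu Qz) (negPf lk) mulr0.
exact: (word_span_sub (skew_BX_X HP) (Hu k)).
Qed.

Lemma torus_inv d0 i j : A d0 i * B d0 j * (A (~~ d0) i * B (~~ d0) j) = 1.
Proof.
rewrite -mulrA (mulrA (B d0 j)) -(gen_AB HG) -(mulrA (A (~~ d0) i)) (gen_Binv HG).
by rewrite mulr1 (gen_Ainv HG).
Qed.

(** * The homogeneous components of Omega and their sum *)

Definition theta (z : lattice n) : U := \sum_(q <- C z) S q.1 * q.2.

Let beta_linr y : linear (fun x => S y * x).
Proof. by move=> a x x'; rewrite mulrDr scalerAr. Qed.

Let beta_linl x : linear (fun y => S y * x).
Proof. by move=> a y y'; rewrite linearP mulrDl scalerAl. Qed.

(** Apply [dual_basis_commutator] to $\beta(y,x) = S(y)x$. As $S$ reverses products and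
    $S(f_i)\omega'_i = -f_i$, the terms $S(f_i v)\,\omega'_i u$ become $-S(v) f_i u$, the first sum
    in degree [z - alpha i]. *)
Lemma theta_F i z : theta z * F i =
  \sum_(q <- C z) S q.1 * F i * q.2 - S (F i) * theta (z - alpha i) * om false i
  - \sum_(q <- C (z - alpha i)) S q.1 * F i * q.2.
Proof.
rewrite /theta mulr_suml; under eq_bigr do rewrite -mulrA.
rewrite (dual_basis_commutator HP HP' (alpha := @alpha n) (z := z) (C := C z)
  (C' := C (z - alpha i)) beta_linr beta_linl); first last.
- exact: dual_pairs_E.
- exact: dual_pairs_F.
- by move=> q /dual_pairs_sub[].
- by move=> q /dual_pairs_sub[].
rewrite mulr_sumr mulr_suml; congr (_ - _ + _); first by apply: eq_bigr => q _; rewrite mulrA.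
  by apply: eq_bigr => q _; rewrite SM !mulrA.
rewrite -sumrN; apply: eq_bigr => q _.
rewrite SM SF mulrN mulNr; congr (- _).
rewrite -[RHS]mulrA -[LHS]mulrA; congr (_ * _).
by rewrite -(mulrA (F i)) (mulrA (om' true i)) (torus_inv true) mul1r.
Qed.

(** The mirror argument, with the members of each dual pair exchanged; here $S(\omega_i) e_i =
    -S(e_i)$ produces the telescoping term. *)
Lemma theta_E i z : S (E i) * theta z =
  \sum_(q <- C z) S q.1 * S (E i) * q.2 - S (om' false i) * theta (z - alpha i) * E i
  - \sum_(q <- C (z - alpha i)) S q.1 * S (E i) * q.2.
Proof.
pose swap (l : seq (U * U)) := [seq (q.2, q.1) | q <- l].
have := dual_basis_commutator HP' HP (alpha := @alpha n) (z := z) (C := swap (C z))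
  (C' := swap (C (z - alpha i))) (i := i) beta_linl beta_linr.
rewrite !big_map /= => H; rewrite /theta mulr_sumr.
under [LHS]eq_bigr do rewrite mulrA -SM.
rewrite {}H; first last.
- by move=> y Fy; rewrite big_map; exact: dual_pairs_F.
- by move=> x Ex; rewrite big_map; exact: dual_pairs_E.
- by move=> q /mapP[q' /dual_pairs_sub[? ?] ->].
- by move=> q /mapP[q' /dual_pairs_sub[? ?] ->].
rewrite mulr_sumr mulr_suml; congr (_ - _ + _); first by apply: eq_bigr => q _; rewrite SM.
  by apply: eq_bigr => q _; rewrite SM !mulrA.
rewrite -sumrN; apply: eq_bigr => q _.
rewrite !SM SA SB SE mulrN mulNr opprK -!mulrA; congr (_ * _).
by rewrite !mulrA (gen_AB HG).
Qed.

(** This is Omega, summed over the whole lattice with zero terms outside the cone, so that the index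
    can be translated. *)
Definition casimir (m : M) : M := \sum_(z \in [set: lattice n]) theta z *: m.

(** A term in degree [z] passes through the weight space of $\lambda + z$, nonzero for finitely many
    [z] only. The free [f] covers both [theta] and the boundary sums that telescope. *)
Lemma finsupp_dual_pairs (f : U -> U) la m : ws la m ->
  finsupp (fun z => (\sum_(q <- C z) f q.1 * q.2) *: m).
Proof.
move=> wm; apply: sub_finite_set (finite_weights_above la) => z /= nz0.
have [Qz|nQ] := pselect (Qplus n z); last first.
  by move: nz0; rewrite /C asboolF // big_nil scale0r eqxx.
split=> //; apply: contrapT => nw; move/negP: nz0; apply; rewrite scaler_suml.
rewrite big_seq big1 // => q /dual_pairs_sub[_ Eq]; rewrite -scalerA.
have wq := weight_span_E Eq wm.
by have [->|nq] := pselect (q.2 *: m = 0); [rewrite scaler0 | case: nw; exists (q.2 *: m)].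
Qed.

Lemma finsupp_theta (m : M) : finsupp (fun z => theta z *: m).
Proof.
elim/weight_vectors_ind: m => [|m m' Hm Hm'|la m wm].
- by apply: (@sub_finite_set _ _ set0) => // z /=; rewrite scaler0 eqxx.
- have := finsupp_add Hm Hm'; apply: sub_finite_set => z /=.
  by rewrite scalerDr.
- exact: finsupp_dual_pairs wm.
Qed.

Lemma casimirD m m' : casimir (m + m') = casimir m + casimir m'.
Proof.
rewrite -fsbig_setTD; [|exact: finsupp_theta|exact: finsupp_theta].
by apply: eq_fsbigr => z _; rewrite scalerDr.
Qed.

Lemma casimir0 : casimir 0 = 0.
Proof. by apply: (addrI (casimir 0)); rewrite -casimirD !addr0. Qed.

Lemma casimirZ (a : K) m : casimir (a%:A *: m) = a%:A *: casimir m.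
Proof.
rewrite [RHS](fsbig_setT_morph ( *:%R a%:A : {additive M -> M}) (finsupp_theta m)).
by apply: eq_fsbigr => z _; exact: scale_algC.
Qed.

(** In degree [z] the factor $u$ raises the weight by [z] and $S(v)$ lowers it by [z]. *)
Lemma weight_space_casimir la m : ws la m -> ws la (casimir m).
Proof.
move=> wm; rewrite /casimir.
rewrite (@fsbig_setTE _ _ [set z | theta z *: m != 0]%classic) //; last exact: finsupp_theta.
elim/big_ind: _ => [||z _]; [exact: weight_space0 | exact: weight_spaceD |].
rewrite scaler_suml big_seq; elim/big_ind: _ => [||q]; [exact: weight_space0 | exact: weight_spaceD |].
case/dual_pairs_sub => Fq Eq; rewrite -scalerA -[la](addrK z).
exact: weight_span_SF (weight_span_E Eq wm).
Qed.

(** Finite support allows the sum to be split, and translation invariance cancels [f] against its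
    translate. *)
Lemma telescope_shift (f g : lattice n -> M) a : finsupp f -> finsupp g ->
  \sum_(z \in [set: lattice n]) (f z - g (z - a) - f (z - a)) =
  - \sum_(z \in [set: lattice n]) g z.
Proof.
move=> ff fg; have fN (h : lattice n -> M) : finsupp h -> finsupp (fun z => - h z).
  by move=> fh; exact: (finsupp_morph (@GRing.opp M : {additive M -> M}) fh).
have sN (h : lattice n -> M) : finsupp h ->
    \sum_(z \in [set: lattice n]) - h z = - \sum_(z \in [set: lattice n]) h z.
  by move=> fh; rewrite (fsbig_setT_morph (@GRing.opp M : {additive M -> M}) fh).
have fsh (h : lattice n -> M) : finsupp h -> finsupp (fun z => - h (z - a)).
  by move=> fh; apply: fN; exact: finsupp_shift.
rewrite fsbig_setTD; [|by apply: finsupp_add => //; exact: fsh|exact: fsh].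
rewrite fsbig_setTD //; last exact: fsh.
rewrite !sN; [|exact: finsupp_shift|exact: finsupp_shift].
by rewrite !fsbig_shift addrAC subrr add0r.
Qed.

Lemma casimir_F i la m : ws la m ->
  casimir (F i *: m) = - (S (F i) *: casimir (om false i *: m)).
Proof.
move=> wm; pose h : {additive M -> M} := *:%R (S (F i)).
have fth := finsupp_theta (om false i *: m).
rewrite -[S (F i) *: _]/(h (casimir _)) (fsbig_setT_morph h fth).
rewrite -(telescope_shift (alpha i) (finsupp_dual_pairs (fun x => S x * F i) wm)); last first.
  exact: finsupp_morph fth.
by apply: eq_fsbigr => z _; rewrite scalerA theta_F !scalerBl -!scalerA.
Qed.

Lemma casimir_E i la m : ws la m ->
  S (E i) *: casimir m = - (S (om' false i) *: casimir (E i *: m)).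
Proof.
move=> wm; pose h : {additive M -> M} := *:%R (S (om' false i)).
pose h' : {additive M -> M} := *:%R (S (E i)).
have fth := finsupp_theta (E i *: m).
rewrite -[S (E i) *: _]/(h' (casimir _)) (fsbig_setT_morph h' (finsupp_theta m)).
rewrite -[S _ *: _]/(h (casimir _)) (fsbig_setT_morph h fth).
rewrite -(telescope_shift (alpha i) (finsupp_dual_pairs (fun x => S x * S (E i)) wm)); last first.
  exact: finsupp_morph fth.
by apply: eq_fsbigr => z _; rewrite -[h' _]/(S (E i) *: _) scalerA theta_E !scalerBl -!scalerA.
Qed.

Lemma om_inv_cancel i (m : M) : om false i *: (om true i *: m) = m.
Proof. by rewrite scalerA (torus_inv false) scale1r. Qed.

(** Multiply [casimir_E] by $\omega_i$: the left side becomes $-e_i\Omega m$, and on the right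
    $\omega_i\omega_i'^{-1}$ acts on the weight $\lambda+\alpha_i$. *)
Lemma casimir_E_weight i la m : ws la m ->
  E i *: casimir m = ((r / s) ^ ip (la + alpha i) (alpha i))%:A *: casimir (E i *: m).
Proof.
move=> wm; have := casimir_E i wm; rewrite SE SM SA SB scaleNr => /oppr_inj.
move/(congr1 ( *:%R (om false i))); rewrite -(scalerA (om true i)) om_inv_cancel => ->.
by rewrite -(gen_AB HG) (weight_space_omega_ratio i (weight_space_casimir (weight_space_E i wm))).
Qed.

(** By [casimir_F], $\Omega f_i = f_i \omega_i'^{-1}\Omega\,\omega_i$. On one weight space
    $\omega_i$ is a scalar and may be moved next to $\omega_i'^{-1}$. *)
Lemma casimir_F_weight i la m : ws la m ->
  casimir (F i *: m) = ((r / s) ^ ip la (alpha i))%:A *: (F i *: casimir m).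
Proof.
move=> wm; have wC := weight_space_casimir wm.
have [a omE] : exists a : K, forall m', ws la m' -> om false i *: m' = a%:A *: m'.
  eexists => m' wm'; rewrite -scalerA (weight_space_B false _ wm') scale_algC.
  by rewrite (weight_space_A false _ wm') scale_algM.
have wC' : ws la (om' true i *: casimir m).
  rewrite -scalerA (weight_space_B true _ wC) scale_algC (weight_space_A true _ wC).
  by do 2 apply: weight_spaceZ.
rewrite (casimir_F i wm) SF scaleNr opprK -(scalerA (F i)) -(scale_algC _ (F i)).
congr (_ *: _); rewrite -(weight_space_omega_ratio i wC) omE // casimirZ.
by rewrite scale_algC (omE _ wC').
Qed.

(** * The operator Xi and commutation with the generators *)

Variable (t : K) (Xi : M -> M).
Hypothesis tE : t ^+ 2 = r / s.
Hypothesis Xi_lin : forall (a : K) m m', Xi (a%:A *: m + m') = a%:A *: Xi m + Xi m'.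
Hypothesis Xi_ws : forall la m, ws la m ->
  Xi m = (t ^ ip (la + two_rho n) la)%:A *: m.

Lemma XiD m m' : Xi (m + m') = Xi m + Xi m'.
Proof. by have := Xi_lin 1 m m'; rewrite !scale1r. Qed.

Lemma Xi0 : Xi 0 = 0.
Proof. by apply: (addrI (Xi 0)); rewrite -XiD !addr0. Qed.

(** The ratio of $g$ at $\lambda+\alpha_i$ and $\lambda$, which is the factor found in
    [casimir_E_weight]. *)
Lemma t_pow_shift la i : t ^ ip (la + alpha i + two_rho n) (la + alpha i) =
  t ^ ip (la + two_rho n) la * (r / s) ^ ip (la + alpha i) (alpha i).
Proof.
have t0 : t != 0.
  by apply: contraTneq (mulf_neq0 hr (invr_neq0 hs)) => t0; rewrite -tE t0 expr0n negbK.
by rewrite ip_shift expfzDr // -tE exprnP exprz_exp.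
Qed.

Lemma casimir_Xi_E i m : casimir (Xi (E i *: m)) = E i *: casimir (Xi m).
Proof.
elim/weight_vectors_ind: m => [|m m' Hm Hm'|la m wm].
- by rewrite scaler0 Xi0 casimir0 scaler0.
- by rewrite scalerDr !XiD !casimirD Hm Hm' scalerDr.
rewrite (Xi_ws wm) (Xi_ws (weight_space_E i wm)) !casimirZ scale_algC.
by rewrite (casimir_E_weight i wm) scale_algM t_pow_shift.
Qed.

Lemma casimir_Xi_F i m : casimir (Xi (F i *: m)) = F i *: casimir (Xi m).
Proof.
elim/weight_vectors_ind: m => [|m m' Hm Hm'|la m wm].
- by rewrite scaler0 Xi0 casimir0 scaler0.
- by rewrite scalerDr !XiD !casimirD Hm Hm' scalerDr.
rewrite (Xi_ws wm) (Xi_ws (weight_space_F i wm)) !casimirZ scale_algC.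
rewrite (casimir_F_weight i wm) scale_algM; congr (_%:A *: _).
(* Applied at $\lambda-\alpha_i$, the ratio becomes $(r/s)^{\langle\lambda,\alpha_i\rangle}$, the
   factor of [casimir_F_weight]. *)
by have := t_pow_shift (la - alpha i) i; rewrite subrK => ->.
Qed.

(** Both operators preserve weight spaces and commute with scalars from [K]; this handles the torus
    generators. *)
Lemma casimir_Xi_scalar (x : U) m :
  (forall la, exists a : K, forall m', ws la m' -> x *: m' = a%:A *: m') ->
  casimir (Xi (x *: m)) = x *: casimir (Xi m).
Proof.
move=> xs; elim/weight_vectors_ind: m => [|m m' Hm Hm'|la m wm].
- by rewrite scaler0 Xi0 casimir0 scaler0.
- by rewrite scalerDr !XiD !casimirD Hm Hm' scalerDr.
have [a ax] := xs la; rewrite ax // (Xi_ws wm) (Xi_ws (weight_spaceZ _ wm)).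
by rewrite !casimirZ (scale_algC _ x) (ax _ (weight_space_casimir wm)).
Qed.

Lemma casimir_Xi_A d0 i m : casimir (Xi (A d0 i *: m)) = A d0 i *: casimir (Xi m).
Proof.
by apply: casimir_Xi_scalar => la; eexists => m'; exact: weight_space_A.
Qed.

Lemma casimir_Xi_B d0 i m : casimir (Xi (B d0 i *: m)) = B d0 i *: casimir (Xi m).
Proof.
by apply: casimir_Xi_scalar => la; eexists => m'; exact: weight_space_B.
Qed.

Lemma casimir_Xi_comm (x : U) m :
  subalg [set y | [\/ exists d0 i, y = A d0 i, exists d0 i, y = B d0 i,
                     exists j, y = E j | exists j, y = F j]] x ->
  casimir (Xi (x *: m)) = x *: casimir (Xi m).
Proof.
move=> gx; elim: gx m => {x} [x gx||x y _ IHx _ IHy|a x _ IHx|x y _ IHx _ IHy] m.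
- case: gx => [[d0 [i ->]]|[d0 [i ->]]|[j ->]|[j ->]].
  + exact: casimir_Xi_A.
  + exact: casimir_Xi_B.
  + exact: casimir_Xi_E.
  + exact: casimir_Xi_F.
- by rewrite !scale1r.
- by rewrite !scalerDl XiD casimirD IHx IHy.
- by rewrite !(scale_algl a x) -[_ *: (x *: m)]addr0 Xi_lin Xi0 addr0 casimirZ IHx.
- by rewrite -!scalerA IHx IHy.
Qed.

Lemma casimirE m : casimir m =
  \sum_(z \in Qplus n) \sum_(k < d z) (S (@v z k) * @u z k) *: m.
Proof.
rewrite [RHS]fsbig_mkcond; apply: eq_fsbigr => z _; rewrite /patch /theta /C.
case: asboolP => Qz; last by rewrite memNset // big_nil scale0r.
by rewrite mem_set // big_map scaler_suml.
Qed.

End WeightModules.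

(** * Specialisation to the two-parameter quantum group *)

Lemma uq_gl_generators (K : fieldType) (n : nat) (r s : K) :
  gl_generators (U := Uq n r s) r s
    (@uA K n r s) (@uB K n r s) (@uE K n r s) (@uF K n r s).
Proof.
split.
- by move=> *; exact: torus_comm.
- by move=> *; exact: torus_comm.
- by move=> *; exact: torus_comm.
- exact: uA_inv.
- exact: uB_inv.
- exact: uA_uE.
- exact: uA_uF.
- exact: uB_uE.
- exact: uB_uF.
Qed.

Lemma uq_generated (K : fieldType) (n : nat) (r s : K) (x : Uq n r s) :
  subalg [set y : Uq n r s | [\/ exists d i, y = uA r s d i,
    exists d i, y = uB r s d i, exists j, y = uE r s j | exists j, y = uF r s j]] x.
Proof.
move: x; apply: uq_gen_ind.
- move=> g; apply: subalg_gen; case: g => [j|j|d i|d i].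
  + by constructor 3; exists j.
  + by constructor 4; exists j.
  + by constructor 1; exists d, i.
  + by constructor 2; exists d, i.
- by rewrite -(scale0r (1 : Uq n r s)); apply: subalg_Z; exact: subalg_1.
- exact: subalg_1.
- by move=> x y; exact: subalg_D.
- by move=> x; rewrite -scaleN1r; exact: subalg_Z.
- by move=> x y; exact: subalg_M.
- by move=> c x; exact: subalg_Z.
Qed.

Theorem theorem4p20 (K : closedFieldType) (n : nat) (r s t : K)
  (hn : (2 <= n)%N) (hr : r != 0) (hs : s != 0) (hrs : r != s)
  (ht : t ^+ 2 = r / s)
  (Delta : {lrmorphism Uq n r s -> Uq2 n r s})
  (S : {linear Uq n r s -> Uq n r s})
  (hHopf : is_hopf Delta S)
  (p : Uq n r s -> Uq n r s -> K)
  (hp : is_hopf_pairing Delta p)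
  (d : lattice n -> nat)
  (u v : forall z : lattice n, 'I_(d z) -> Uq n r s)
  (hu : forall z : lattice n, Qplus n z -> is_basis (Uplus r s z) (u z))
  (hv : forall z : lattice n, Qplus n z -> is_basis (Uminus_opp r s z) (v z))
  (hvu : forall z : lattice n, Qplus n z -> forall k l, p (v z k) (u z l) = (k == l)%:R)
  (M : lmodType (Uq n r s)) (hM : in_catO M)
  (Xi : M -> M) (hXi : is_Xi t Xi) :
  forall (x : Uq n r s) (m : M),
    Omega S u v (Xi (x *: m)) = x *: Omega S u v (Xi m).

Proof.
move=> x m.
have HG := uq_gl_generators n r s.
have M_sum m' : exists (l : seq (lattice n)) (y : lattice n -> M),
  (forall la, la \in l -> weight_vectors r s (@uA K n r s) (@uB K n r s) la (y la))
  /\ m' = \sum_(la <- l) y la.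
  have [l [y [_ yl ->]]] := catO_sum hM m'; exists l, y; split=> // la /yl[_].
  exact.
have HEF := pairing_EF hr hs hHopf hp; have HFE := pairing_FE hr hs hHopf hp.
have comm := casimir_Xi_comm hr hs HG (antipode_1 hHopf) (antipode_M hHopf)
  (antipode_A hHopf) (antipode_B hHopf) (antipode_E hHopf) (antipode_F hHopf)
  M_sum (catO_bounded hM) HEF HFE hu hv hvu ht (Xi_linear hXi) (Xi_weight hXi)
  m (uq_generated x).
have OmE m' : Omega S u v m' = casimir S u v m' by rewrite casimirE.
by rewrite !OmE.
Qed.
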